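(* Let $M,M'\in\mathrm{Inv}_n(\Lambda)$. There are $U,V\in\mathrm{GL}_n(\Lambda)$ with $UMV=M'$ if and only if there are $\hat U,\hat V\in\mathrm{GL}_n(\mathbb{A}_\Lambda)$ with $\hat UM\hat V=M'$.
   Context: Let $\mathbb{K}$ be a number field and let $\Omega$ be either a finite field extension of $\mathbb{K}$ or a central simple $\mathbb{K}$-algebra which is a division algebra; fix a maximal order $\Lambda\subseteq\Omega$. Standing assumption: if $\Omega$ is noncommutative then $n\ge2$. $\mathbb{A}_\Lambda$ denotes the adeles of $\Omega$ integral at all finite places (with $\Omega\subseteq\mathbb{A}_\Omega$ diagonally), and $\mathrm{Inv}_n(\Lambda)=\mathrm{GL}_n(\Omega)\cap\mathrm{Mat}_n(\Lambda)$. *)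

(* Defs.v *)
From HB Require Import structures.
From mathcomp Require Import all_boot all_order all_algebra all_field.
From mathcomp Require Import algebraics_fundamentals.
From mathcomp Require Import generic_quotient ring_quotient.
From mathcomp Require Import boolp classical_sets functions cardinality reals.
From mathcomp Require Import ring.

Set Implicit Arguments.
Unset Strict Implicit.
Unset Printing Implicit Defensive.

Import Order.TTheory GRing.Theory Num.Theory.

Local Open Scope classical_set_scope.
Local Open Scope ring_scope.
Local Open Scope quotient_scope.

(* A ring topology, given by a basis of neighbourhoods of 0. *)
Record ring_topology (A : pzRingType) := RingTopology {
  nbhs0 : set (set A);
  nbhs0_ex : nbhs0 !=set0;
  nbhs0_0 : forall U, nbhs0 U -> U 0;
  nbhs0_I : forall U V, nbhs0 U -> nbhs0 V ->
    exists2 W, nbhs0 W & W `<=` U `&` V;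
  nbhs0_B : forall U, nbhs0 U ->
    exists2 W, nbhs0 W & forall x y, W x -> W y -> U (x - y);
  nbhs0_M : forall U, nbhs0 U ->
    exists2 W, nbhs0 W & forall x y, W x -> W y -> U (x * y);
  nbhs0_Ml : forall a U, nbhs0 U ->
    exists2 W, nbhs0 W & forall x, W x -> U (a * x);
  nbhs0_Mr : forall a U, nbhs0 U ->
    exists2 W, nbhs0 W & forall x, W x -> U (x * a)
}.

Section Completion.
Variables (A : pzRingType) (T : ring_topology A).

Definition cauchy_seq (s : nat -> A) := forall U, nbhs0 T U ->
  exists N, forall i j, (N <= i)%N -> (N <= j)%N -> U (s i - s j).

Definition null_seq (s : nat -> A) := forall U, nbhs0 T U ->
  exists N, forall i, (N <= i)%N -> U (s i).

Definition cauchyb : {pred nat -> A} := fun s => `[< cauchy_seq s >].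

Lemma null0 : null_seq 0.
Proof. by move=> U /nbhs0_0 U0; exists 0%N. Qed.

Lemma nullB s t : null_seq s -> null_seq t -> null_seq (s - t).
Proof.
move=> ns nt U /nbhs0_B[W BW WU].
have [N1 H1] := ns _ BW; have [N2 H2] := nt _ BW.
exists (maxn N1 N2) => i; rewrite geq_max => /andP[i1 i2].
by apply: WU; [apply: H1|apply: H2].
Qed.

Lemma cauchyB s t : cauchy_seq s -> cauchy_seq t -> cauchy_seq (s - t).
Proof.
move=> cs ct U /nbhs0_B[W BW WU].
have [N1 H1] := cs _ BW; have [N2 H2] := ct _ BW.
exists (maxn N1 N2) => i j; rewrite !geq_max => /andP[i1 i2] /andP[j1 j2].
have -> : (s - t) i - (s - t) j = (s i - s j) - (t i - t j).
  by rewrite /= !opprD addrACA.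
by apply: WU; [apply: H1|apply: H2].
Qed.

Lemma nbhs0_D U : nbhs0 T U ->
  exists2 W, nbhs0 T W & forall x y, W x -> W y -> U (x + y).
Proof.
move=> /nbhs0_B[W BW WU]; have [W1 BW1 W1W] := nbhs0_B BW.
have [W2 BW2 sW2] := nbhs0_I BW BW1; exists W2 => // x y /sW2[Wx _] /sW2[_ W1y].
rewrite -[y]opprK; apply: WU => //; rewrite -[- y]sub0r.
by apply: W1W => //; exact: nbhs0_0 BW1.
Qed.

(* Cauchy sequences are bounded: [s i] multiplies one fixed neighbourhood into
   [U], for all large [i]. *)
Lemma cauchy_bddl s U : cauchy_seq s -> nbhs0 T U ->
  exists W N, nbhs0 T W /\ forall i x, (N <= i)%N -> W x -> U (s i * x).
Proof.
move=> cs /nbhs0_D[W BW WU].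
have [W1 BW1 H1] := nbhs0_M BW; have [N HN] := cs _ BW1.
have [W2 BW2 H2] := nbhs0_Ml (s N) BW.
have [W3 BW3 sW3] := nbhs0_I BW1 BW2.
exists W3, N; split=> // i x Ni /sW3[W1x W2x].
rewrite -[s i](subrK (s N)) mulrDl; apply: WU; last exact: H2.
by apply: H1 => //; apply: HN.
Qed.

Lemma cauchy_bddr s U : cauchy_seq s -> nbhs0 T U ->
  exists W N, nbhs0 T W /\ forall i x, (N <= i)%N -> W x -> U (x * s i).
Proof.
move=> cs /nbhs0_D[W BW WU].
have [W1 BW1 H1] := nbhs0_M BW; have [N HN] := cs _ BW1.
have [W2 BW2 H2] := nbhs0_Mr (s N) BW.
have [W3 BW3 sW3] := nbhs0_I BW1 BW2.
exists W3, N; split=> // i x Ni /sW3[W1x W2x].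
rewrite -[s i](subrK (s N)) mulrDr; apply: WU; last exact: H2.
by apply: H1 => //; apply: HN.
Qed.

Lemma cauchyM s t : cauchy_seq s -> cauchy_seq t -> cauchy_seq (s * t).
Proof.
move=> cs ct U /nbhs0_D[W BW WU].
have [W1 [N1 [BW1 H1]]] := cauchy_bddl cs BW.
have [W2 [N2 [BW2 H2]]] := cauchy_bddr ct BW.
have [M1 K1] := ct _ BW1; have [M2 K2] := cs _ BW2.
exists (maxn (maxn N1 N2) (maxn M1 M2)) => i j.
rewrite !geq_max => /andP[/andP[i1 i2] /andP[i3 i4]].
move=> /andP[/andP[j1 j2] /andP[j3 j4]].
have -> : (s * t) i - (s * t) j = s i * (t i - t j) + (s i - s j) * t j.
  by rewrite /= mulrBr mulrBl addrA subrK.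
by apply: WU; [apply: H1 => //; apply: K1|apply: H2 => //; apply: K2].
Qed.

Lemma nullMl s t : cauchy_seq s -> null_seq t -> null_seq (s * t).
Proof.
move=> cs nt U BU; have [W [N [BW HW]]] := cauchy_bddl cs BU.
have [M HM] := nt _ BW; exists (maxn N M) => i.
by rewrite geq_max => /andP[Ni Mi]; apply: HW => //; apply: HM.
Qed.

Lemma nullMr s t : cauchy_seq s -> null_seq t -> null_seq (t * s).
Proof.
move=> cs nt U BU; have [W [N [BW HW]]] := cauchy_bddr cs BU.
have [M HM] := nt _ BW; exists (maxn N M) => i.
by rewrite geq_max => /andP[Ni Mi]; apply: HW => //; apply: HM.
Qed.

Lemma cauchy_cst a : cauchy_seq (cst a).
Proof. by move=> U /nbhs0_0 U0; exists 0%N => i j _ _; rewrite /= subrr. Qed.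

Fact cauchyb_subring : subring_closed cauchyb.
Proof.
split=> [|s t|s t]; first by apply/asboolP; exact: cauchy_cst.
- by move=> /asboolP cs /asboolP ct; apply/asboolP/cauchyB.
- by move=> /asboolP cs /asboolP ct; apply/asboolP/cauchyM.
Qed.

HB.instance Definition _ :=
  GRing.isSubringClosed.Build (nat -> A) cauchyb cauchyb_subring.

Record cauchy_ring :=
  CauchySeq { cauchy_val :> nat -> A; cauchy_valP : cauchy_val \in cauchyb }.

HB.instance Definition _ := [isSub for cauchy_val].
HB.instance Definition _ := [Choice of cauchy_ring by <:].
HB.instance Definition _ := GRing.SubChoice_isSubPzRing.Build
  (nat -> A) cauchyb cauchy_ring cauchyb_subring.

Definition nullb : {pred cauchy_ring} := fun s => `[< null_seq (val s) >].

Fact nullb_zmod : zmod_closed nullb.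
Proof.
split=> [|s t]; first by apply/asboolP; rewrite rmorph0; exact: null0.
move=> /asboolP ns /asboolP nt; apply/asboolP; rewrite rmorphB; exact: nullB.
Qed.

HB.instance Definition _ :=
  GRing.isZmodClosed.Build cauchy_ring nullb nullb_zmod.

Definition completion : Type := Quotient.quot nullb.

HB.instance Definition _ := GRing.Zmodule.on completion.
HB.instance Definition _ := EqQuotient.on completion.

Definition completion_one : completion := \pi_completion 1.
Definition completion_mul : completion -> completion -> completion :=
  fun x y => \pi_completion (repr x * repr y).

Lemma cauchy_ringP (s : cauchy_ring) : cauchy_seq (val s).
Proof. exact/asboolP/(valP s). Qed.

Lemma pi_completionP (s t : cauchy_ring) :
  (\pi_completion s = \pi_completion t) <-> (s - t \in nullb).
Proof.
rewrite [_ \in _](Quotient.idealrBE nullb); split=> [|/eqP]; last exact.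
by move=> e; apply/eqP.
Qed.

Lemma completion_mulE (s t : cauchy_ring) :
  completion_mul (\pi_completion s) (\pi_completion t) = \pi_completion (s * t).
Proof.
rewrite /completion_mul; set s' := repr _; set t' := repr _.
have /pi_completionP/asboolP es : \pi_completion s' = \pi_completion s.
  by rewrite /s' reprK.
have /pi_completionP/asboolP et : \pi_completion t' = \pi_completion t.
  by rewrite /t' reprK.
apply/pi_completionP.
rewrite (_ : _ - _ = s' * (t' - t) + (s' - s) * t); last first.
  by rewrite mulrBr mulrBl addrA subrK.
apply: rpredD; apply/asboolP; rewrite rmorphM.
  by apply: nullMl => //; exact: cauchy_ringP.
by apply: nullMr => //; exact: cauchy_ringP.
Qed.

Lemma pi_completionD (s t : cauchy_ring) :
  \pi_completion (s + t) = \pi_completion s + \pi_completion t.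
Proof. exact: (Quotient.pi_add nullb s t). Qed.

Lemma completionP (x : completion) : exists s, x = \pi_completion s.
Proof. by exists (repr x); rewrite reprK. Qed.

Fact completion_mulA : associative completion_mul.
Proof.
move=> x y z; have [s ->] := completionP x; have [t ->] := completionP y.
by have [u ->] := completionP z; rewrite !completion_mulE mulrA.
Qed.

Fact completion_1mul : left_id completion_one completion_mul.
Proof.
by move=> x; have [s ->] := completionP x; rewrite completion_mulE mul1r.
Qed.

Fact completion_mul1 : right_id completion_one completion_mul.
Proof.
by move=> x; have [s ->] := completionP x; rewrite completion_mulE mulr1.
Qed.

Fact completion_mulDl : left_distributive completion_mul +%R.
Proof.
move=> x y z; have [s ->] := completionP x; have [t ->] := completionP y.
have [u ->] := completionP z.
by rewrite -pi_completionD !completion_mulE mulrDl pi_completionD.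
Qed.

Fact completion_mulDr : right_distributive completion_mul +%R.
Proof.
move=> x y z; have [s ->] := completionP x; have [t ->] := completionP y.
have [u ->] := completionP z.
by rewrite -pi_completionD !completion_mulE mulrDr pi_completionD.
Qed.

HB.instance Definition _ := GRing.Zmodule_isPzRing.Build completion
  completion_mulA completion_1mul completion_mul1
  completion_mulDl completion_mulDr.

Definition to_completion (a : A) : completion :=
  \pi_completion (CauchySeq (introT (asboolP _) (cauchy_cst a))).

(* The closure of the image of [L]: limits of Cauchy sequences in [L]. *)
Definition completion_closure (L : set A) : set completion :=
  [set x | exists2 s : cauchy_ring,
             (forall i, L (cauchy_val s i)) & x = \pi_completion s].

End Completion.

Arguments to_completion {A} T a.
Arguments completion_closure {A} T L.

Section CoordTopology.
Variables (K : fieldType) (T : ring_topology K) (Om : falgType K).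

Local Notation coo := (coord (vbasis {:Om})).

Definition coord_nbhs (U : set K) : set Om := [set x | forall i, U (coo i x)].

Definition coord_nbhs0 : set (set Om) := coord_nbhs @` nbhs0 T.

Lemma nbhs0_fin (I : finType) (P : I -> set K -> Prop) :
  (forall i U V, V `<=` U -> P i U -> P i V) ->
  (forall i, exists2 W, nbhs0 T W & P i W) ->
  exists2 W, nbhs0 T W & forall i, P i W.
Proof.
move=> Pmono H.
suff [W BW HW] : exists2 W, nbhs0 T W & forall i, i \in enum I -> P i W.
  by exists W => // i; apply: HW; rewrite mem_enum.
elim: (enum I) => [|i r [W BW HW]]; first by have [W BW] := nbhs0_ex T; exists W.
have [W1 BW1 HW1] := H i; have [W2 BW2 sW2] := nbhs0_I BW BW1.
exists W2 => // j; rewrite inE => /predU1P[->|jr].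
  by apply: Pmono HW1 => x /sW2[].
by apply: Pmono (HW _ jr) => x /sW2[].
Qed.

Lemma nbhs0_sum (I : Type) (r : seq I) U : nbhs0 T U ->
  exists2 W, nbhs0 T W &
    forall f : I -> K, (forall i, W (f i)) -> U (\sum_(i <- r) f i).
Proof.
elim: r U => [|i r IH] U BU.
  by exists U => // f _; rewrite big_nil; exact: nbhs0_0 BU.
have [W BW HW] := nbhs0_D BU; have [W1 BW1 HW1] := IH _ BW.
have [W2 BW2 sW2] := nbhs0_I BW BW1.
exists W2 => // f Hf; rewrite big_cons; apply: HW.
  by have /sW2[] := Hf i.
by apply: HW1 => j; have /sW2[] := Hf j.
Qed.

Lemma coord_lin (f : {linear Om -> Om}) U : nbhs0 T U ->
  exists2 W, nbhs0 T W & coord_nbhs W `<=` f @^-1` coord_nbhs U.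
Proof.
move=> BU.
have [W1 BW1 H1] := nbhs0_sum (enum 'I_(\dim {:Om})) BU.
pose g (p : 'I_(\dim {:Om}) * 'I_(\dim {:Om})) :=
  coo p.1 (f (vbasis {:Om})`_p.2).
have [|p|W BW HW] := @nbhs0_fin _ (fun p V => forall x, V x -> W1 (x * g p)).
- by move=> p U' V sVU H x /sVU; exact: H.
- exact: nbhs0_Mr.
exists W => // x Wx k; rewrite [in X in _ (f X)](coord_vbasis (memvf x)).
rewrite linear_sum linear_sum -big_enum; apply: H1 => i.
by rewrite !linearZ /=; exact: (HW (k, i)).
Qed.

Lemma coord_nbhs_ex : coord_nbhs0 !=set0.
Proof. by have [U BU] := nbhs0_ex T; exists (coord_nbhs U), U. Qed.

Lemma coord_nbhs_0 U : coord_nbhs0 U -> U 0.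
Proof. by move=> [V BV <-] i; rewrite linear0; exact: nbhs0_0 BV. Qed.

Lemma coord_nbhs_I U V : coord_nbhs0 U -> coord_nbhs0 V ->
  exists2 W, coord_nbhs0 W & W `<=` U `&` V.
Proof.
move=> [U' BU <-] [V' BV <-]; have [W BW sW] := nbhs0_I BU BV.
by exists (coord_nbhs W); [exists W|move=> x Wx; split=> i; have /sW[] := Wx i].
Qed.

Lemma coord_nbhs_B U : coord_nbhs0 U ->
  exists2 W, coord_nbhs0 W & forall x y, W x -> W y -> U (x - y).
Proof.
move=> [U' BU <-]; have [W BW sW] := nbhs0_B BU.
exists (coord_nbhs W); first by exists W.
by move=> x y Wx Wy i; rewrite linearB; apply: sW; [exact: Wx|exact: Wy].
Qed.

Lemma coord_nbhs_M U : coord_nbhs0 U ->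
  exists2 W, coord_nbhs0 W & forall x y, W x -> W y -> U (x * y).
Proof.
move=> [U' BU <-]; set d := \dim {:Om}.
have [W1 BW1 H1] := nbhs0_sum (enum 'I_d) BU.
have [W2 BW2 H2] := nbhs0_sum (enum 'I_d) BW1.
pose g (p : 'I_d * ('I_d * 'I_d)) :=
  coo p.1 ((vbasis {:Om})`_p.2.1 * (vbasis {:Om})`_p.2.2).
have [|p|W3 BW3 H3] := @nbhs0_fin _ (fun p V => forall x, V x -> W2 (x * g p)).
- by move=> p U1 V sVU H x /sVU; exact: H.
- exact: nbhs0_Mr.
have [W4 BW4 H4] := nbhs0_M BW3.
exists (coord_nbhs W4); first by exists W4.
move=> x y Wx Wy k.
rewrite (coord_vbasis (memvf x)) (coord_vbasis (memvf y)) mulr_suml linear_sum.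
rewrite -big_enum; apply: H1 => i; rewrite mulr_sumr linear_sum -big_enum.
apply: H2 => j; rewrite -scalerAl -scalerAr !linearZ /= mulrA.
by apply: (H3 (k, (i, j))); apply: H4; [exact: Wx|exact: Wy].
Qed.

Lemma coord_nbhs_Ml a U : coord_nbhs0 U ->
  exists2 W, coord_nbhs0 W & forall x, W x -> U (a * x).
Proof.
move=> [U' BU <-].
have [W BW sW] := coord_lin (amull a) BU.
exists (coord_nbhs W); first by exists W.
by move=> x /sW; rewrite /preimage /= lfunE.
Qed.

Lemma coord_nbhs_Mr a U : coord_nbhs0 U ->
  exists2 W, coord_nbhs0 W & forall x, W x -> U (x * a).
Proof.
move=> [U' BU <-].
have [W BW sW] := coord_lin (amulr a) BU.
exists (coord_nbhs W); first by exists W.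
by move=> x /sW; rewrite /preimage /= lfunE.
Qed.

(* This topology does not depend on the basis, and the completion of [Om] for it
   is the scalar extension of [Om] to the completion of [K]. *)
Definition coord_topology : ring_topology Om :=
  RingTopology coord_nbhs_ex coord_nbhs_0 coord_nbhs_I coord_nbhs_B
    coord_nbhs_M coord_nbhs_Ml coord_nbhs_Mr.

End CoordTopology.

Section Places.
Variables (R : realType) (K : fieldExtType rat).

Definition OK : set K := [set x | integralOver (intr : int -> K) x].

Record finite_place := FinitePlace {
  prime_ideal :> K -> Prop;
  prime_ideal_sub : prime_ideal `<=` OK;
  prime_ideal0 : prime_ideal 0;
  prime_idealD : forall x y,
    prime_ideal x -> prime_ideal y -> prime_ideal (x + y);
  prime_idealM : forall a x, OK a -> prime_ideal x -> prime_ideal (a * x);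
  prime_ideal1 : ~ prime_ideal 1;
  prime_idealP : forall x y, OK x -> OK y ->
    prime_ideal (x * y) -> prime_ideal x \/ prime_ideal y;
  prime_ideal_neq0 : exists2 x, prime_ideal x & x != 0
}.

(* Each class of archimedean absolute values contains exactly one that extends
   the usual absolute value of the rationals, so these represent the infinite
   places without repetition. *)
Record infinite_place := InfinitePlace {
  inf_abs :> K -> R;
  inf_abs_ge0 : forall x, 0 <= inf_abs x;
  inf_abs_eq0 : forall x, inf_abs x = 0 -> x = 0;
  inf_absM : forall x y, inf_abs (x * y) = inf_abs x * inf_abs y;
  inf_absD : forall x y, inf_abs (x + y) <= inf_abs x + inf_abs y;
  inf_abs_nat : forall m : nat, inf_abs m%:R = m%:R
}.

Definition place := (finite_place + infinite_place)%type.

Lemma OK0 : OK 0. Proof. exact: (integral0 intr). Qed.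
Lemma OK1 : OK 1. Proof. exact: (integral1 intr). Qed.
Lemma OKB x y : OK x -> OK y -> OK (x - y).
Proof. exact: (@integral_sub _ _ intr). Qed.
Lemma OKM x y : OK x -> OK y -> OK (x * y).
Proof. exact: (@integral_mul _ _ intr). Qed.

Lemma OK_int (m : int) : OK m%:~R.
Proof. exact: (integral_id intr). Qed.

Lemma OKX x k : OK x -> OK (x ^+ k).
Proof. by move=> Ox; elim: k => [|k IH]; rewrite ?exprS; [exact: OK1|exact: OKM]. Qed.

Lemma OK_frac_aux (b c x : K) (n i : nat) : (i <= n)%N ->
  b ^+ (n - i) * c * (b * x) ^+ i = b ^+ n * (c * x ^+ i).
Proof. by move=> le_in; rewrite exprMn mulrACA -exprD subnK. Qed.

Lemma OK_frac (x : K) : exists2 d, OK d & d != 0 /\ OK (d * x).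
Proof.
have [p mp px] := alg_integral x.
pose a := \prod_(i < size p) denq p`_i.
have aP i : exists m : int, a%:~R * in_alg K p`_i = m%:~R.
  have [ip|] := ltnP i (size p); last first.
    by move=> /(nth_default 0) ->; exists 0; rewrite rmorph0 mulr0.
  exists (numq p`_i * \prod_(j < size p | j != Ordinal ip) denq p`_j).
  rewrite /a (bigD1 (Ordinal ip)) //= !rmorphM /= mulrAC; congr (_ * _).
  by rewrite -!(rmorph_int (in_alg K)) -rmorphM mulrC -numqE.
have a0 : (a%:~R : K) != 0.
  have -> : (a%:~R : K) = in_alg K a%:~R by rewrite rmorph_int.
  rewrite fmorph_eq0 intr_eq0; apply/prodf_neq0 => i _; exact: denq_neq0.
exists a%:~R; first exact: OK_int.
split=> //.
set n := (size p).-1.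
have sp : size p = n.+1 by rewrite /n prednK // size_poly_gt0 monic_neq0.
pose q : {poly K} := \poly_(i < n.+1) (a%:~R ^+ (n - i) * in_alg K p`_i).
have qn : q`_n = 1.
  rewrite coef_poly ltnSn subnn expr0 mul1r.
  have /monicP := mp; rewrite lead_coefE sp /= => ->; exact: (rmorph1 (in_alg K)).
have sq : size q = n.+1.
  by apply: size_poly_eq; have := qn; rewrite coef_poly ltnSn => ->; exact: oner_neq0.
apply: (@integral_root_monic _ _ intr _ q).
- by rewrite monicE lead_coefE sq /= qn.
- rewrite rootE horner_poly.
  have -> : \sum_(i < n.+1) a%:~R ^+ (n - i) * in_alg K p`_i * (a%:~R * x) ^+ i
          = a%:~R ^+ n * (map_poly (in_alg K) p).[x].
    rewrite horner_coef size_map_poly sp mulr_sumr; apply: eq_bigr => i _.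
    by rewrite coef_map; apply: OK_frac_aux; rewrite -ltnS.
  by rewrite (rootP px) mulr0.
- apply/integral_poly => i; rewrite coef_poly; case: ltnP => [ni|_]; last exact: OK0.
  have [m mE] := aP i.
  move: ni; rewrite ltnS leq_eqVlt => /predU1P[->|ni].
    have := qn; rewrite coef_poly ltnSn => ->; exact: OK1.
  rewrite -(subnSK ni) exprSr -mulrA mE.
  by apply: OKM (OK_int _); apply: OKX; exact: OK_int.
Qed.

Definition local_ring (p : finite_place) : set K :=
  [set x | exists a s, [/\ OK a, OK s, ~ p s & x = a / s]].

(* [local_ring p] is a discrete valuation ring, so the sets [padic_nbhs p c],
   for nonzero [c], are the (fractional) powers of its maximal ideal; allowing
   every [c] makes the axioms of a ring topology immediate. *)
Definition padic_nbhs (p : finite_place) (c : K) : set K :=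
  [set x | exists2 y, local_ring p y & x = c * y].

Definition padic_nbhs0 (p : finite_place) : set (set K) :=
  [set U | exists2 c, c != 0 & U = padic_nbhs p c].

Section Padic.
Variable p : finite_place.
Local Notation Op := (local_ring p).

Lemma nonprime_neq0 s : ~ p s -> s != 0.
Proof. by move=> ps; apply/eqP => s0; apply: ps; rewrite s0; exact: prime_ideal0. Qed.

Lemma nonprimeM s t : OK s -> OK t -> ~ p s -> ~ p t -> ~ p (s * t).
Proof. by move=> Os Ot ps pt /(prime_idealP Os Ot)[]. Qed.

Lemma local_OK x : OK x -> Op x.
Proof.
by move=> Ox; exists x, 1; split; rewrite ?divr1 //; [exact: OK1|exact: prime_ideal1].
Qed.

Lemma localB x y : Op x -> Op y -> Op (x - y).
Proof.
move=> [a [s [Oa Os ps ->]]] [b [t [Ob Ot pt ->]]].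
exists (a * t - b * s), (s * t); split; [|exact: OKM|exact: nonprimeM|].
  by apply: OKB; exact: OKM.
rewrite mulrBl; congr (_ - _); last by rewrite [s * t]mulrC -mulf_div divff ?mulr1 // nonprime_neq0.
by rewrite -mulf_div divff ?mulr1 // nonprime_neq0.
Qed.

Lemma localM x y : Op x -> Op y -> Op (x * y).
Proof.
move=> [a [s [Oa Os ps ->]]] [b [t [Ob Ot pt ->]]].
exists (a * b), (s * t); split; [exact: OKM|exact: OKM|exact: nonprimeM|].
by rewrite mulf_div.
Qed.

Lemma padic_sub c c' : c != 0 -> OK (c' / c) ->
  padic_nbhs p c' `<=` padic_nbhs p c.
Proof.
move=> c0 Oc x [y Oy ->]; exists ((c' / c) * y); last by rewrite mulrA mulrCA divff ?mulr1.
by apply: localM => //; exact: local_OK.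
Qed.

Lemma padic_ex : padic_nbhs0 p !=set0.
Proof. by exists (padic_nbhs p 1), 1; rewrite ?oner_neq0. Qed.

Lemma padic_0 U : padic_nbhs0 p U -> U 0.
Proof. by move=> [c _ ->]; exists 0; rewrite ?mulr0 //; exact: local_OK OK0. Qed.

Lemma padic_I U V : padic_nbhs0 p U -> padic_nbhs0 p V ->
  exists2 W, padic_nbhs0 p W & W `<=` U `&` V.
Proof.
move=> [c c0 ->] [c' c0' ->].
have [d Od [d0 Od1]] := OK_frac c; have [e Oe [e0 Oe1]] := OK_frac c'.
exists (padic_nbhs p (d * c * (e * c'))).
  by exists (d * c * (e * c')); rewrite ?mulf_neq0.
move=> x Wx; split; apply: padic_sub Wx => //.
  by rewrite mulrAC mulfK //; apply: OKM.
by rewrite mulrA mulfK //; apply: OKM.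
Qed.

Lemma padic_B U : padic_nbhs0 p U ->
  exists2 W, padic_nbhs0 p W & forall x y, W x -> W y -> U (x - y).
Proof.
move=> [c c0 ->]; exists (padic_nbhs p c); first by exists c.
move=> _ _ [x Ox ->] [y Oy ->]; rewrite -mulrBr; exists (x - y) => //.
exact: localB.
Qed.

Lemma padic_Ml a U : padic_nbhs0 p U ->
  exists2 W, padic_nbhs0 p W & forall x, W x -> U (a * x).
Proof.
move=> [c c0 ->]; have [d Od [d0 Oda]] := OK_frac a.
exists (padic_nbhs p (c * d)); first by exists (c * d); rewrite ?mulf_neq0.
move=> _ [x Ox ->]; exists (d * a * x); last by ring.
by apply: localM => //; exact: local_OK.
Qed.

Lemma padic_Mr a U : padic_nbhs0 p U ->
  exists2 W, padic_nbhs0 p W & forall x, W x -> U (x * a).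
Proof.
move=> /(padic_Ml a)[W BW HW]; exists W => // x /HW.
by rewrite mulrC.
Qed.

Lemma padic_M U : padic_nbhs0 p U ->
  exists2 W, padic_nbhs0 p W & forall x y, W x -> W y -> U (x * y).
Proof.
move=> [c c0 ->]; have [d Od [d0 Odc]] := OK_frac c.
exists (padic_nbhs p (d * c)); first by exists (d * c); rewrite ?mulf_neq0.
move=> _ _ [x Ox ->] [y Oy ->]; exists (d * x * (d * c * y)).
  by apply: localM; apply: localM => //; exact: local_OK.
by ring.
Qed.

Definition padic_topology : ring_topology K :=
  RingTopology padic_ex padic_0 padic_I padic_B padic_M padic_Ml padic_Mr.

End Padic.

Section Archimedean.
Variable v : infinite_place.

Definition arch_nbhs (e : R) : set K := [set x | v x < e].

Definition arch_nbhs0 : set (set K) :=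
  [set U | exists2 e, 0 < e & U = arch_nbhs e].

Lemma inf_abs0 : v 0 = 0.
Proof. by rewrite -[0 : K]/(0%:R) inf_abs_nat. Qed.

Lemma inf_absN x : v (- x) = v x.
Proof.
have vN1 : v (-1) = 1.
  apply/eqP; rewrite -(@pexpr_eq1 _ _ 2) ?inf_abs_ge0 // expr2 -inf_absM mulrNN.
  by rewrite mulr1 -[1 : K]/(1%:R) inf_abs_nat.
by rewrite -mulN1r inf_absM vN1 mul1r.
Qed.

Lemma arch_ex : arch_nbhs0 !=set0.
Proof. by exists (arch_nbhs 1), 1; rewrite ?ltr01. Qed.

Lemma arch_0 U : arch_nbhs0 U -> U 0.
Proof. by move=> [e e0 ->]; rewrite /arch_nbhs /= inf_abs0. Qed.

Lemma arch_I U V : arch_nbhs0 U -> arch_nbhs0 V ->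
  exists2 W, arch_nbhs0 W & W `<=` U `&` V.
Proof.
move=> [e e0 ->] [d d0 ->]; exists (arch_nbhs (Num.min e d)).
  by exists (Num.min e d); rewrite ?lt_min ?e0.
by move=> x; rewrite /arch_nbhs /= lt_min => /andP[].
Qed.

Lemma arch_B U : arch_nbhs0 U ->
  exists2 W, arch_nbhs0 W & forall x y, W x -> W y -> U (x - y).
Proof.
move=> [e e0 ->]; exists (arch_nbhs (e / 2)).
  by exists (e / 2); rewrite ?divr_gt0.
move=> x y vx vy; rewrite /arch_nbhs /=.
by rewrite (le_lt_trans (inf_absD _ _ _)) // inf_absN [e]splitr ltrD.
Qed.

Lemma arch_M U : arch_nbhs0 U ->
  exists2 W, arch_nbhs0 W & forall x y, W x -> W y -> U (x * y).
Proof.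
move=> [e e0 ->]; exists (arch_nbhs (Num.min 1 e)).
  by exists (Num.min 1 e); rewrite ?lt_min ?ltr01.
move=> x y; rewrite /arch_nbhs /= !lt_min => /andP[vx _] /andP[_ vy].
by rewrite inf_absM -[e]mul1r ltr_pM ?inf_abs_ge0.
Qed.

Lemma arch_Ml a U : arch_nbhs0 U ->
  exists2 W, arch_nbhs0 W & forall x, W x -> U (a * x).
Proof.
move=> [e e0 ->]; have va : 0 < v a + 1 by rewrite ltr_wpDl ?inf_abs_ge0.
exists (arch_nbhs (e / (v a + 1))).
  by exists (e / (v a + 1)); rewrite ?divr_gt0.
move=> x; rewrite /arch_nbhs /= ltr_pdivlMr // inf_absM [v a * _]mulrC.
by apply: le_lt_trans; rewrite ler_wpM2l ?inf_abs_ge0 // lerDl.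
Qed.

Lemma arch_Mr a U : arch_nbhs0 U ->
  exists2 W, arch_nbhs0 W & forall x, W x -> U (x * a).
Proof.
move=> /(arch_Ml a)[W BW HW]; exists W => // x /HW.
by rewrite mulrC.
Qed.

Definition arch_topology : ring_topology K :=
  RingTopology arch_ex arch_0 arch_I arch_B arch_M arch_Ml arch_Mr.

End Archimedean.

Definition place_topology (v : place) : ring_topology K :=
  match v with inl p => padic_topology p | inr w => arch_topology w end.

End Places.

Section Orders.
Variables (K : fieldExtType rat) (Om : falgType K).

Definition commutative_algebra := forall x y : Om, x * y = y * x.

Definition division_algebra := forall x : Om, x != 0 -> x \is a GRing.unit.

Definition central_algebra := ('Z({:Om}) = 1)%VS.

Definition simple_algebra := forall I : {vspace Om},
  ({:Om} * I <= I)%VS -> (I * {:Om} <= I)%VS -> I = 0%VS \/ I = fullv.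

Definition finite_field_extension := commutative_algebra /\ division_algebra.

Definition central_division_algebra :=
  [/\ central_algebra, simple_algebra & division_algebra].

Record is_order (L : set Om) : Prop := IsOrder {
  order1 : L 1;
  orderB : forall x y, L x -> L y -> L (x - y);
  orderM : forall x y, L x -> L y -> L (x * y);
  orderZ : forall a x, OK a -> L x -> L (a *: x);
  order_fg : exists m (e : 'I_m -> Om), (forall i, L (e i)) /\
    forall x, L x -> exists a : 'I_m -> K,
      (forall i, OK (a i)) /\ x = \sum_(i < m) a i *: e i;
  order_span : exists2 s : seq Om, (forall x, x \in s -> L x) & <<s>>%VS = fullv
}.

Definition maximal_order (L : set Om) :=
  is_order L /\ forall L', is_order L' -> L `<=` L' -> L' = L.

End Orders.

Section Matrices.
Variables (A : pzRingType) (n : nat).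

Definition Mat (S : set A) : set 'M[A]_n := [set M | forall i j, S (M i j)].

Definition GL (S : set A) : set 'M[A]_n := [set M | Mat S M /\
  exists2 N, Mat S N & M *m N = 1%:M /\ N *m M = 1%:M].

End Matrices.

Definition InvMat (K : fieldExtType rat) (Om : falgType K) (n : nat) (L : set Om)
  : set 'M[Om]_n := GL setT `&` Mat L.

Section RingProduct.
Variables (I : Type) (F : I -> pzRingType).

Definition ring_product := forall i, F i.

HB.instance Definition _ := Choice.on ring_product.

Implicit Types x y z : ring_product.

Let zero : ring_product := fun=> 0.
Let one : ring_product := fun=> 1.
Let opp x : ring_product := fun i => - x i.
Let add x y : ring_product := fun i => x i + y i.
Let mul x y : ring_product := fun i => x i * y i.

Fact prod_addA : associative add.
Proof. by move=> x y z; apply: functional_extensionality_dep => i; exact: addrA. Qed.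
Fact prod_addC : commutative add.
Proof. by move=> x y; apply: functional_extensionality_dep => i; exact: addrC. Qed.
Fact prod_add0 : left_id zero add.
Proof. by move=> x; apply: functional_extensionality_dep => i; exact: add0r. Qed.
Fact prod_addN : left_inverse zero opp add.
Proof. by move=> x; apply: functional_extensionality_dep => i; exact: addNr. Qed.

HB.instance Definition _ := GRing.isZmodule.Build ring_product
  prod_addA prod_addC prod_add0 prod_addN.

Fact prod_mulA : associative mul.
Proof. by move=> x y z; apply: functional_extensionality_dep => i; exact: mulrA. Qed.
Fact prod_1mul : left_id one mul.
Proof. by move=> x; apply: functional_extensionality_dep => i; exact: mul1r. Qed.
Fact prod_mul1 : right_id one mul.
Proof. by move=> x; apply: functional_extensionality_dep => i; exact: mulr1. Qed.
Fact prod_mulDl : left_distributive mul +%R.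
Proof. by move=> x y z; apply: functional_extensionality_dep => i; exact: mulrDl. Qed.
Fact prod_mulDr : right_distributive mul +%R.
Proof. by move=> x y z; apply: functional_extensionality_dep => i; exact: mulrDr. Qed.

HB.instance Definition _ := GRing.Zmodule_isPzRing.Build ring_product
  prod_mulA prod_1mul prod_mul1 prod_mulDl prod_mulDr.

End RingProduct.

Section Adeles.
Variables (R : realType) (K : fieldExtType rat) (Om : falgType K).

Definition local_topology (v : place R K) : ring_topology Om :=
  coord_topology (place_topology v) Om.

Definition local_completion (v : place R K) : pzRingType :=
  completion (local_topology v).

Definition place_product : pzRingType := ring_product local_completion.

Definition adele_diag (a : Om) : place_product :=
  fun v => to_completion (local_topology v) a.

Definition local_order (L : set Om) (v : place R K) : set (local_completion v) :=
  completion_closure (local_topology v) L.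

(* The adele ring as a subset of the full product of all completions; its
   condition at almost all finite places is the same for every order [L]. *)
Definition adeles (L : set Om) : set place_product :=
  [set x | finite_set
             [set p : finite_place K | ~ local_order L (x (inl p))]].

Definition integral_adeles (L : set Om) : set place_product :=
  adeles L `&` [set x | forall p : finite_place K, local_order L (x (inl p))].

End Adeles.

Arguments adele_diag R {K Om} a.

(* Main.v *)
From HB Require Import structures.
From Stdlib Require RelationClasses Ncring Ncring_tac.
Require Import Defs.
From mathcomp Require Import all_boot all_order all_algebra all_field.
From mathcomp Require Import ring zify.
From mathcomp Require Import boolp classical_sets functions cardinality reals.

(* Let [I] be the two-sided ideal of [L] generated by the entries of [M].  As [L]
   is maximal, [I] is invertible.  Choose an integer [c > 0] with [c M^-1] and
   [c M'^-1] integral, and let [B] be the finite ring [L / c L].  Gluing the local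
   equivalences along central idempotents gives units [u], [v] of ['M_n(B)] with
   [u M v = M'].  If [Y] has entries in the inverse of [I] then [1 + M Y] is
   integral and [(1 + M Y) M = M (1 + Y M)]; since [I] is invertible, such
   matrices represent every class of units of ['M_n(B)] modulo elementary matrices,
   so [u = E w] with [E] elementary and [w] preserving the image of [M] when
   [n >= 2].  Elementary matrices lift to [GL_n(L)], and for a lift of [E] the
   matrix [M^-1 E^-1 M'] and its inverse are integral because [c] is divisible by
   [M] and [M'].  For commutative [L] and [n <= 1] one takes [E = 1]. *)

Set Implicit Arguments.
Unset Strict Implicit.
Unset Printing Implicit Defensive.

Import Order.TTheory GRing.Theory Num.Theory.

Local Open Scope classical_set_scope.
Local Open Scope ring_scope.
Local Open Scope quotient_scope.

(** Units of ['M[B]_n] do not lift to [GL_n(L)] in general, already over the integers because of the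
    determinant, so the congruence [u M v = M'] cannot be lifted as it stands. What remains free is
    to change [u] on the right by a unit [w] with [w M 'M[B]_n = M 'M[B]_n], which the unknown [V]
    absorbs; this freedom turns out to be as large as the obstruction. The reason is local. Modulo
    elementary matrices a unit is a product of diagonal factors [1 + x] with [x] in the corner of a
    local idempotent. Since [1] is a sum of products [a * (M i j * y)] with [y] in the inverse
    ideal, one of them is invertible in that corner, so [x] factors through some [M i j * y]. For
    [n >= 2] the factors [1 + p q] and [1 + q p] agree up to elementary matrices, which brings the
    entry of [M] to the front. Maximality of [L] enters through right orders: that of a two-sided
    fractional ideal is [L]. Invertibility of [I] follows by nilpotency arguments in the finite ring
    [L / c L]. *)

Section NoncommutativeRing.
Variable A : pzRingType.

(** Registers every [pzRingType] for the normalisation of noncommutative identities, most of which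
    live below in matrix rings. *)
#[global] Instance pzRing_ops : @Ncring.Ring_ops A 0 1 +%R *%R
  (fun x y => x - y) -%R eq := {}.

#[global] Instance pzRing_ring : @Ncring.Ring A 0 1 +%R *%R
  (fun x y => x - y) -%R eq pzRing_ops.
Proof.
split; first exact: RelationClasses.eq_equivalence.
all: try by repeat move=> ? ? ->.
all: move=> *; by [exact: add0r|exact: addrC|exact: addrA|exact: mul1r
  |exact: mulr1|exact: mulrA|exact: mulrDl|exact: mulrDr|exact: subrr].
Qed.

End NoncommutativeRing.

Ltac nc_ring := Ncring_tac.non_commutative_ring.

(** * Local idempotents in finite rings *)

Section Corner.
Variable B : pzRingType.
Implicit Types e f x y u : B.

(** Membership in [e B e], a ring with unit [e] when [e] is idempotent; as a predicate it needs no
    new ring type for each [e]. *)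
Definition corner e x := e * x = x /\ x * e = x.

Definition corner_unit e x := exists y, [/\ corner e y, x * y = e & y * x = e].

Definition nilpotent_elt x := exists k, x ^+ k = 0.

(** The ring [e B e] is local with nilpotent maximal ideal elements; in a finite ring these are the
    primitive idempotents. *)
Definition local_idem e := [/\ e * e = e, e != 0 &
  forall x, corner e x -> nilpotent_elt x \/ corner_unit e x].

Definition two_sided_unit u := exists u', u * u' = 1 /\ u' * u = 1.

Lemma cornerD e x y : corner e x -> corner e y -> corner e (x + y).
Proof. by move=> [ex xe] [ey ye]; split; rewrite ?mulrDr ?mulrDl ?ex ?xe ?ey ?ye. Qed.

Lemma cornerN e x : corner e x -> corner e (- x).
Proof. by move=> [ex xe]; split; rewrite ?mulrN ?mulNr ?ex ?xe. Qed.

Lemma cornerM e x y : corner e x -> corner e y -> corner e (x * y).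
Proof. by move=> [ex _] [_ ye]; split; rewrite ?mulrA ?ex -?mulrA ?ye. Qed.

Lemma corner_idem e : e * e = e -> corner e e.
Proof. by []. Qed.

Lemma corner_mid e x : e * e = e -> corner e (e * x * e).
Proof. by move=> ee; split; rewrite ?mulrA ?ee -?mulrA ?ee. Qed.

Lemma corner_exp e x k : corner e x -> corner e (x ^+ k.+1).
Proof.
move=> cx; elim: k => [|k IH]; first by rewrite expr1.
by rewrite exprS; exact: cornerM.
Qed.

(** The product [y ^+ m * e * x ^+ m] equals [e] for every [m], yet it vanishes for large [m]. Here
    [y] may lie outside the corner. *)
Lemma nilpotent_linv e x y : local_idem e -> corner e x ->
  nilpotent_elt x -> y * x = e -> False.
Proof.
move=> [ee e0 _] [ex xe] [k xk] yx.
have H m : y ^+ m * e * x ^+ m = e.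
  elim: m => [|m IH]; first by rewrite !expr0 mul1r mulr1.
  rewrite exprSr exprS -!mulrA (mulrA e) ex (mulrA y) yx.
  by rewrite mulrA.
by case/eqP: e0; rewrite -(H k) xk mulr0.
Qed.

Lemma nilpotent_rinv e x y : local_idem e -> corner e x ->
  nilpotent_elt x -> x * y = e -> False.
Proof.
move=> [ee e0 _] [ex xe] [k xk] xy.
have H m : x ^+ m * (e * y ^+ m) = e.
  elim: m => [|m IH]; first by rewrite !expr0 mul1r mulr1.
  rewrite exprSr exprS -!mulrA (mulrA x e) xe (mulrA x) xy.
  exact: IH.
by case/eqP: e0; rewrite -(H k) xk mul0r.
Qed.

Lemma corner_unit_rinv e x y : local_idem e -> corner e x -> x * y = e ->
  corner_unit e x.
Proof.
by move=> le cx xy; case: (le) => _ _ /(_ x cx)[/(nilpotent_rinv le cx)/(_ xy)|].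
Qed.

Lemma two_sided_unit_1B x : nilpotent_elt x -> two_sided_unit (1 - x).
Proof.
move=> [k xk]; exists (\sum_(i < k) x ^+ i).
have e1 : (1 - x) * \sum_(i < k) x ^+ i = 1.
  by rewrite -opprB mulNr -subrX1 xk sub0r opprK.
split=> //; rewrite -[RHS]e1 mulr_sumr mulr_suml; apply: eq_bigr => i _.
by rewrite mulrBl mulrBr mul1r mulr1 -exprS -exprSr.
Qed.

Lemma corner_unit_subr e x : local_idem e -> corner e x -> nilpotent_elt x ->
  corner_unit e (e - x).
Proof.
move=> le [ex xe] /two_sided_unit_1B[z [z1 _]].
have [ee _ _] := le; apply: (@corner_unit_rinv _ _ (z * e)) => //.
  by apply: cornerD; [exact: corner_idem|apply: cornerN].
by rewrite -{1}[e]mulr1 -{1}ex -mulrBr mulrA -(mulrA e) z1 mulr1.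
Qed.

(** If [v] inverts [x + y], then [x * v] is a unit, or it is nilpotent and [y * v = e - x * v] is a
    unit. *)
Lemma corner_unitD e x y : local_idem e -> corner e x -> corner e y ->
  corner_unit e (x + y) -> corner_unit e x \/ corner_unit e y.
Proof.
move=> le cx cy [v [cv xyv _]].
case: (le) => _ _ /(_ _ (cornerM cx cv))[nx|[w [_ xw _]]]; last first.
  by left; apply: (@corner_unit_rinv _ _ (v * w)); rewrite // mulrA.
right; have [w [_ yw _]] := corner_unit_subr le (cornerM cx cv) nx.
apply: (@corner_unit_rinv _ _ (v * w)) => //; rewrite mulrA -yw; congr (_ * _).
by rewrite -xyv mulrDl addrAC subrr add0r.
Qed.

Lemma corner_unit_sum e (I : eqType) (r : seq I) (F : I -> B) : local_idem e ->
  (forall i, corner e (F i)) -> corner_unit e (\sum_(i <- r) F i) ->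
  exists2 i, i \in r & corner_unit e (F i).
Proof.
move=> le cF; elim: r => [|i r IH].
  rewrite big_nil => -[y [_ + _]]; rewrite mul0r => e0.
  by case: le => _ /eqP; rewrite -e0.
rewrite big_cons => /(corner_unitD le (cF i))[|ui|/IH[j jr uj]].
- split; rewrite ?mulr_sumr ?mulr_suml; apply: eq_bigr => j _; by case: (cF j).
- by exists i; rewrite ?mem_head.
- by exists j; rewrite // inE jr orbT.
Qed.

Lemma two_sided_unitM u v :
  two_sided_unit u -> two_sided_unit v -> two_sided_unit (u * v).
Proof.
move=> [u' [uu' u'u]] [v' [vv' v'v]]; exists (v' * u').
by rewrite !mulrA -(mulrA u) vv' mulr1 uu' -(mulrA v') u'u mulr1 v'v.
Qed.

Lemma two_sided_unit_sq0 x : x * x = 0 -> two_sided_unit (1 + x).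
Proof.
move=> xx; exists (1 - x).
split.
  by rewrite (_ : _ * _ = 1 - x * x); [rewrite xx subr0|nc_ring].
by rewrite (_ : _ * _ = 1 - x * x); [rewrite xx subr0|nc_ring].
Qed.

(** The element [1 + (x - e)] is [x] on the corner of [e] and the identity on the complementary
    one. *)
Lemma two_sided_unit_corner e x : e * e = e -> corner_unit e x -> corner e x ->
  two_sided_unit (1 + (x - e)).
Proof.
move=> ee [y [[ey ye] xy yx]] [ex xe]; exists (1 + (y - e)).
split.
  rewrite (_ : _ * _ = 1 + (x * y - e) - (x * e - x) - (e * y - y)
    + (e * e - e)); last by nc_ring.
  by rewrite xy xe ey ee !subrr !subr0 !addr0.
rewrite (_ : _ * _ = 1 + (y * x - e) - (y * e - y) - (e * x - x)
  + (e * e - e)); last by nc_ring.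
by rewrite yx ye ex ee !subrr !subr0 !addr0.
Qed.

End Corner.

Definition orthogonal_idems (B : pzRingType) (es : seq B) :=
  [/\ uniq es, forall e, e \in es -> local_idem e &
      forall e f, e \in es -> f \in es -> e != f -> e * f = 0].

Section FiniteRing.
Variables (B : pzRingType) (s : seq B) (Bfin : forall x, x \in s).
Implicit Types e f x y u : B.

Lemma pigeonhole (f : nat -> B) :
  exists i j, [/\ (i < j)%N, (j <= size s)%N & f i = f j].
Proof.
have := uniq_leq_size (s1 := mkseq f (size s).+1) (s2 := s).
rewrite size_mkseq ltnn => H.
have nu : ~ uniq (mkseq f (size s).+1).
  by move=> /H -/(_ (fun x _ => Bfin x)).
apply: contrapT => nex; apply/nu/mkseq_uniqP => i j; rewrite !inE !ltnS => si sj fij.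
by have [ij|ji|//] := ltngtP i j; case: nex; [exists i, j|exists j, i].
Qed.

Lemma idempotent_power x : exists k, x ^+ k.+1 * x ^+ k.+1 = x ^+ k.+1.
Proof.
have [i [j [ij _ xij]]] := pigeonhole (fun m => x ^+ m).
have per1 m : (i <= m)%N -> x ^+ (m + (j - i)) = x ^+ m.
  move=> /subnK <-; rewrite -addnA subnKC 1?ltnW //.
  by rewrite exprD -xij -exprD.
have per m r : (i <= m)%N -> x ^+ (m + r * (j - i)) = x ^+ m.
  move=> im; elim: r => [|r IH]; first by rewrite mul0n addn0.
  by rewrite mulSn addnCA addnC per1 // (leq_trans im) ?leq_addr.
have d0 : (0 < j - i)%N by rewrite subn_gt0.
(* The exponent is a multiple of the period [j - i] and at least [i], so doubling it does not change
   the power. *)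
exists (i.+1 * (j - i)).-1; rewrite prednK ?muln_gt0 //.
by rewrite -exprD per // (leq_trans (leqnSn i)) // leq_pmulr.
Qed.

(** Some positive power of [x] is an idempotent of the corner: if it is [0] then [x] is nilpotent,
    if it is [e] then [x] is invertible. *)
Lemma local_idem_primitive e : e * e = e -> e != 0 ->
  (forall f, f * f = f -> corner e f -> f = 0 \/ f = e) -> local_idem e.
Proof.
move=> ee e0 prim; split=> // x cx; have [k ff] := idempotent_power x.
have [xk0|xke] := prim _ ff (corner_exp k cx); [by left; exists k.+1|right].
have [ex xe] := cx.
(* For [k = 0] the power is [1], which need not lie in the corner; hence the factors [e]. *)
exists (e * x ^+ k * e); split; first exact: corner_mid.
  by rewrite !mulrA xe -exprS xke.
by rewrite -!mulrA ex -exprSr xke.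
Qed.

Lemma corner_sub e f x : corner e f -> corner f x -> corner e x.
Proof.
move=> [ef fe] [fx xf]; split; first by rewrite -[in LHS]fx mulrA ef.
by rewrite -[in LHS]xf -mulrA fe.
Qed.

Let celts e := [seq x <- undup s | (e * x == x) && (x * e == x)].

(** Induction on the number of elements of the corner: if [e] is not primitive it splits as
    [f + (e - f)], and [e] itself is missing from both smaller corners. *)
Lemma local_decomposition_corner (m : nat) e : e * e = e ->
  (size (celts e) < m)%N ->
  exists es, [/\ orthogonal_idems es, forall f, f \in es -> corner e f &
                 \sum_(f <- es) f = e].
Proof.
elim: m e => // m IH e ee; rewrite ltnS => szm.
have [->|e0] := eqVneq e 0; first by exists [::]; rewrite big_nil.
have [/(local_idem_primitive ee e0) le|nprim] := pselect (forall f, f * f = f ->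
    corner e f -> f = 0 \/ f = e).
  exists [:: e]; split; rewrite ?big_seq1 //; last first.
    by move=> f; rewrite inE => /eqP ->; exact: corner_idem.
  split=> // [f|f g]; rewrite !inE => /eqP -> //.
  by move=> /eqP ->; rewrite eqxx.
have [f [ff [cf [f0 fe]]]] : exists f, f * f = f /\ corner e f /\ f <> 0 /\ f <> e.
  apply: contrapT => nex; apply: nprim => f ff cf.
  apply: contrapT => /not_orP[f0 fe]; apply: nex; by exists f.
have [ef fe'] := cf.
have sz g : corner e g -> g <> e ->
    (size (celts g) < m)%N.
  move=> cg ge; apply: leq_trans szm.
  have sub : {subset e :: celts g <= celts e}.
    move=> x; rewrite inE !mem_filter !mem_undup => /orP[/eqP ->|].
      by rewrite ee eqxx Bfin.
    move=> /andP[/andP[/eqP gx /eqP xg] ->]; rewrite andbT.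
    by have [-> ->] : corner e x by [exact: corner_sub cg _]; rewrite eqxx.
  apply: (uniq_leq_size _ sub); rewrite /= filter_uniq ?undup_uniq // andbT.
  rewrite mem_filter; apply/negP => /andP[/andP[/eqP eg _] _]; apply: ge.
  by rewrite -eg; case: cg.
have [es1 [[u1 l1 o1] c1 s1]] := IH f ff (sz f cf fe).
have gg : (e - f) * (e - f) = e - f.
  rewrite (_ : _ * _ = e * e - e * f - f * e + f * f); last by nc_ring.
  by rewrite ee ef fe' ff subrK.
have ce : corner e (e - f) by apply: cornerD; [|apply: cornerN].
have nfe : e - f <> e by move=> /(congr1 (fun x => e - x)); rewrite opprB addrC subrK subrr.
have [es2 [[u2 l2 o2] c2 s2]] := IH _ gg (sz _ ce nfe).
have o12 x y : x \in es1 -> y \in es2 -> x * y = 0 /\ y * x = 0.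
  move=> /c1[fx xf] /c2[gy yg].
  split.
    by rewrite -xf -gy mulrA -(mulrA x) mulrBr fe' ff subrr mulr0 mul0r.
  by rewrite -fx -yg mulrA -(mulrA y) mulrBl ef ff subrr mulr0 mul0r.
exists (es1 ++ es2); split; last 1 first.
- by rewrite big_cat /= s1 s2 addrC subrK.
- split.
  + rewrite cat_uniq u1 u2 andbT; apply/hasPn => x x2; apply/negP => x1.
    have [xx _] := o12 _ _ x1 x2; have [xx' /eqP x0 _] := l1 _ x1.
    by apply: x0; rewrite -xx' xx.
  + by move=> x; rewrite mem_cat => /orP[/l1|/l2].
  + move=> x y; rewrite !mem_cat => /orP[x1|x2] /orP[y1|y2] xy; auto.
    * by case: (o12 x y).
    * by case: (o12 y x).
- move=> x; rewrite mem_cat => /orP[/c1|/c2]; exact: corner_sub.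
Qed.

Lemma local_decomposition :
  exists es : seq B, orthogonal_idems es /\ \sum_(f <- es) f = 1.
Proof.
have [es [o _ s1]] := local_decomposition_corner (mulr1 1) (leqnn _).
by exists es.
Qed.

End FiniteRing.

(** * Induction on units by Gaussian elimination *)

Section UnitInduction.
Variables (R : pzRingType) (es : seq R) (P : R -> Prop).
Hypotheses (oes : orthogonal_idems es) (es1 : \sum_(e <- es) e = 1) (P1 : P 1).
Hypothesis Ptransvection : forall e f x u, e \in es -> f \in es -> e != f ->
  P ((1 + e * x * f) * u) -> P u.
Hypothesis Pdiagonal : forall e x u, e \in es -> corner e x ->
  two_sided_unit (1 + x) -> P ((1 + x) * u) -> P u.

(** The factors [1 + g * x * e] multiply without cross terms, because [e] is orthogonal to every [g]
    in [r]. *)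
Lemma unit_ind_column e x u (r : seq R) : e \in es ->
  (forall g, g \in r -> g \in es /\ g != e) ->
  P ((1 + (\sum_(g <- r) g) * (x * e)) * u) -> P u.
Proof.
have [_ les orth] := oes.
move=> ees; elim: r u => [|g r IH] u Hr.
  by rewrite big_nil mul0r addr0 mul1r.
have [ges ge] := Hr g (mem_head _ _).
have Hr' h : h \in r -> h \in es /\ h != e by move=> hr; apply: Hr; rewrite inE hr orbT.
rewrite big_cons => H; apply: (IH _ Hr'); apply: (Ptransvection (x := x) ges ees ge).
rewrite mulrA; congr (P (_ * _)): H.
have e0 : e * (\sum_(h <- r) h) = 0.
  rewrite mulr_sumr big_seq big1 // => h /Hr'[hes he].
  by apply: orth; rewrite // eq_sym.
rewrite [RHS](_ : _ = 1 + (g + \sum_(h <- r) h) * (x * e)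
  + g * x * (e * (\sum_(h <- r) h)) * x * e); last by nc_ring.
by rewrite e0 mulr0 !mul0r addr0.
Qed.

(* Gaussian elimination on columns, the columns [u * g] being the blocks. *)
Lemma unit_ind_seq (r : seq R) u : {subset r <= es} -> two_sided_unit u ->
  (forall g, g \in es -> g \notin r -> u * g = g) -> P u.
Proof.
have [ues les orth] := oes.
elim: r u => [|e r IH] u res uu ufix.
  suff -> : u = 1 by [].
  rewrite -[u]mulr1 -[in LHS]es1 mulr_sumr -[RHS]es1 big_seq [RHS]big_seq.
  by apply: eq_bigr => g /ufix ->.
have ees : e \in es by apply: res; rewrite mem_head.
have le := les _ ees; have [ee e0 ledich] := le.
have {}IH v : two_sided_unit v -> v * e = e ->
    (forall g, g \in es -> g \notin e :: r -> v * g = g) -> P v.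
  move=> vv ve vfix; apply: IH => // [g gr|g ges gr].
    by apply: res; rewrite inE gr orbT.
  by have [->//|ge] := eqVneq g e; apply: vfix; rewrite // inE negb_or ge.
(* It suffices to treat an invertible pivot [e * v * e]; otherwise the pivot is nilpotent and a
   single transvection repairs it. *)
suff red v : two_sided_unit v -> corner_unit e (e * v * e) ->
    (forall g, g \in es -> g \notin e :: r -> v * g = g) -> P v.
  have [u' [uu' u'u]] := uu.
  have [ueu|nue] := pselect (corner_unit e (e * u * e)); first exact: red ufix.
  have [nil|//] := ledich _ (corner_mid u ee).
  (* The elements [e * (u' * g * u) * e] add up to [e], so one of them is a unit of the corner. *)
  have [||g ges ung] := @corner_unit_sum _ e _ es (fun g => e * (u' * g * u) * e) le.
  - by move=> g; exact: corner_mid.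
  - rewrite -mulr_suml -mulr_sumr -mulr_suml -mulr_sumr es1 mulr1 u'u mulr1 ee.
    by exists e; rewrite ee; split.
  have ge : g != e.
    apply/eqP => ge; move: ung; rewrite ge => -[w [_ _ wu]].
    apply: (nilpotent_linv (y := w * (e * u')) le (corner_mid u ee) nil).
    by rewrite -[RHS]wu !mulrA.
  (* The block [g] is none of those already cleared: on these [u'] is the identity, which would give
     [e * u' * g = e * g = 0]. *)
  have gfix h : h \in es -> h \notin e :: r -> g != h.
    move=> hes hr; apply/eqP => gh; have ug := ufix _ hes hr.
    have u'g : u' * h = h by rewrite -{1}ug mulrA u'u mul1r.
    have eh : e * h = 0 by rewrite orth // -gh eq_sym.
    case: ung => w [_ + _]; rewrite gh u'g !mulrA eh !mul0r.
    by move=> e0'; case/eqP: e0.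
  apply: (Ptransvection (x := u') ees ges); first by rewrite eq_sym.
  apply: red.
  - apply: two_sided_unitM uu; apply: two_sided_unit_sq0.
    by rewrite !mulrA -(mulrA _ g e) (orth g e) // mulr0 !mul0r.
  (* The new pivot minus the old one is a unit and the old one is nilpotent, so the new one is a
     unit. *)
  - have : corner_unit e (e * ((1 + e * u' * g) * u) * e + - (e * u * e)).
      rewrite [X in corner_unit e X](_ : _ = (e * e) * (u' * g * u) * e); last by nc_ring.
      by rewrite ee.
    move/(corner_unitD le (corner_mid _ ee) (cornerN (corner_mid u ee))).
    case=> //.
    move=> [w [_ nw _]]; case: (nilpotent_rinv (y := - w) le (corner_mid u ee) nil).
    by rewrite mulrN -mulNr.
  - move=> h hes hr; rewrite -mulrA ufix // mulrDl mul1r -mulrA (orth g h) ?gfix //.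
    by rewrite mulr0 addr0.
move=> vv [a' [[ea' a'e] aa' a'a]] vfix.
have [r' r'e r's] : exists2 r', (forall g, g \in r' -> g \in es /\ g != e) &
    \sum_(g <- r') g = 1 - e.
  exists [seq g <- es | g != e] => [g|]; first by rewrite mem_filter => /andP[-> ->].
  by rewrite big_filter -es1 [in RHS](bigD1_seq e) //= addrAC subrr add0r.
(* With [a'] the inverse of the pivot, this clears the column of [e] outside the block [e]. *)
apply: (unit_ind_column (x := - (v * a')) ees r'e); rewrite r's mulNr -mulrA a'e.
have cae : corner e (e * v * e) := corner_mid v ee.
have fixa' g : g \in es -> g \notin e :: r -> a' * g = 0.
  move=> ges; rewrite inE negb_or => /andP[ge _].
  by rewrite -a'e -mulrA (orth e g) ?mulr0 // eq_sym.
have uL : two_sided_unit (1 + (1 - e) * - (v * a')).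
  apply: two_sided_unit_sq0.
  rewrite [LHS](_ : _ = (1 - e) * v * (a' - a' * e) * v * a'); last by nc_ring.
  by rewrite a'e subrr mulr0 !mul0r.
have uD : two_sided_unit (1 + (a' - e)).
  by apply: two_sided_unit_corner => //; exists (e * v * e).
(* The pivot is then normalised to [e]. *)
apply: (@Pdiagonal e (a' - e)) => //.
  by apply: cornerD => //; apply/cornerN/corner_idem.
have a'v : a' * v * e = e by rewrite -[RHS]a'a !mulrA a'e.
apply: IH.
- by apply: two_sided_unitM => //; apply: two_sided_unitM.
- rewrite -mulrA (_ : _ * v * e = v * e - (1 - e) * v * (a' * v * e)); last by nc_ring.
  rewrite a'v (_ : v * e - _ = e * v * e); last by nc_ring.
  rewrite (_ : _ * _ = e * v * e + a' * (e * v * e) - (e * e) * v * e); last by nc_ring.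
  by rewrite ee a'a addrAC subrr add0r.
- move=> g ges gr; have eg : e * g = 0.
    apply: orth => //; move: gr; rewrite inE negb_or => /andP[+ _].
    by rewrite eq_sym.
  rewrite -!mulrA (vfix g) // (_ : _ * g = g - (1 - e) * v * (a' * g)); last by nc_ring.
  rewrite fixa' // mulr0 subr0 mulrDl mul1r mulrBl fixa' // eg subrr addr0 //.
Qed.

Lemma unit_ind u : two_sided_unit u -> P u.
Proof. by move=> uu; apply: (@unit_ind_seq es) => // g ->. Qed.

End UnitInduction.

(** * Elementary matrices over finite rings *)

Section ElementaryMatrices.
Variables (B : pzRingType) (n : nat).
Implicit Types (a b c d : 'I_n) (x y : B) (E : 'M[B]_n).

(** The matrix unit at [(a, b)] scaled by [x]; in general not an invertible matrix. *)
Definition unit_mx a b x : 'M[B]_n := x *: delta_mx a b.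

Lemma unit_mxE a b x i j : unit_mx a b x i j = x *+ ((i == a) && (j == b)).
Proof. by rewrite !mxE; case: andP => _; rewrite ?mulr1 ?mulr0. Qed.

Lemma unit_mxMl a b x (u : 'M[B]_n) i j :
  (unit_mx a b x * u) i j = (x * u b j) *+ (i == a).
Proof.
rewrite mxE (bigD1 b) //= big1 ?addr0 => [|k kb].
  by rewrite unit_mxE eqxx andbT; case: (i == a); rewrite // mul0r.
by rewrite unit_mxE (negbTE kb) andbF mul0r.
Qed.

Lemma unit_mxMr a b x (u : 'M[B]_n) i j :
  (u * unit_mx a b x) i j = (u i a * x) *+ (j == b).
Proof.
rewrite mxE (bigD1 a) //= big1 ?addr0 => [|k ka].
  by rewrite unit_mxE eqxx /=; case: (j == b); rewrite // mulr0.
by rewrite unit_mxE (negbTE ka) mulr0.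
Qed.

Lemma unit_mxM a b c d x y :
  unit_mx a b x * unit_mx c d y = unit_mx a d (x * y *+ (b == c)).
Proof.
apply/matrixP => i j; rewrite unit_mxMl !unit_mxE.
by case: (i == a); case: (b == c); case: (j == d); rewrite // mulr0.
Qed.

Lemma unit_mxM0 a b c d x y : b != c -> unit_mx a b x * unit_mx c d y = 0.
Proof. by move=> /negbTE bc; rewrite unit_mxM bc mulr0n /unit_mx scale0r. Qed.

Lemma unit_mxMM a b d x y : unit_mx a b x * unit_mx b d y = unit_mx a d (x * y).
Proof. by rewrite unit_mxM eqxx. Qed.

Lemma unit_mxD a b x y : unit_mx a b (x + y) = unit_mx a b x + unit_mx a b y.
Proof. exact: scalerDl. Qed.

Lemma unit_mxN a b x : unit_mx a b (- x) = - unit_mx a b x.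
Proof. exact: scaleNr. Qed.

Lemma unit_mx0 a b : unit_mx a b 0 = 0.
Proof. exact: scale0r. Qed.

Lemma unit_mxMdl a i j x y :
  unit_mx a a x * unit_mx i j y = unit_mx i j (x * y *+ (a == i)).
Proof. by rewrite unit_mxM; case: eqP => [->|]; rewrite ?unit_mx0. Qed.

Lemma unit_mxMdr a i j x y :
  unit_mx i j x * unit_mx a a y = unit_mx i j (x * y *+ (j == a)).
Proof. by rewrite unit_mxM; case: eqP => [->|]; rewrite ?unit_mx0. Qed.

Lemma unit_mx_sum1 : \sum_a unit_mx a a 1 = 1.
Proof.
by rewrite -[RHS]/(1%:M) scalar_mx_sum_delta; apply: eq_bigr => a _.
Qed.

(** The group [E_n(B)]; inverses need no constructor, since the inverse of a generator is a
    generator. *)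
Inductive elementary : 'M[B]_n -> Prop :=
| elementary1 : elementary 1
| elementaryM a b x E : a != b -> elementary E ->
    elementary ((1 + unit_mx a b x) * E).

Lemma elementary_gen a b x : a != b -> elementary (1 + unit_mx a b x).
Proof. by move=> ab; rewrite -[_ + _]mulr1; apply: elementaryM => //; exact: elementary1. Qed.

Lemma elementary_mul E F : elementary E -> elementary F -> elementary (E * F).
Proof.
move=> eE eF; elim: eE => [|a b x {}E ab _ IH]; first by rewrite mul1r.
by rewrite -mulrA; exact: elementaryM.
Qed.

Lemma elementary_genV a b x : a != b ->
  (1 + unit_mx a b x) * (1 + unit_mx a b (- x)) = 1.
Proof.
move=> ab; rewrite unit_mxN [LHS](_ : _ = 1 - unit_mx a b x * unit_mx a b x).
  by rewrite unit_mxM0 ?subr0 // eq_sym.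
by nc_ring.
Qed.

Lemma elementary_Vgen a b x : a != b ->
  (1 + unit_mx a b (- x)) * (1 + unit_mx a b x) = 1.
Proof. by move=> ab; rewrite -[x in X in _ * X]opprK elementary_genV. Qed.

Lemma elementary_inv E : elementary E ->
  exists F, [/\ elementary F, E * F = 1 & F * E = 1].
Proof.
elim=> [|a b x {}E ab _ [F [eF EF FE]]].
  by exists 1; rewrite mulr1; split=> //; exact: elementary1.
exists (F * (1 + unit_mx a b (- x))); split.
- by apply: elementary_mul => //; exact: elementary_gen.
- by rewrite mulrA -(mulrA _ E) EF mulr1 elementary_genV.
- rewrite mulrA -(mulrA F) elementary_Vgen //.
  by rewrite mulr1.
Qed.

Lemma elementary_unit E : elementary E -> two_sided_unit E.
Proof. by case/elementary_inv => F [_ EF FE]; exists F. Qed.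

Lemma elementary_column k (r : seq 'I_n) (f : 'I_n -> B) : k \notin r ->
  elementary (1 + \sum_(i <- r) unit_mx i k (f i)).
Proof.
elim: r => [|i r IH]; first by rewrite big_nil addr0 => _; exact: elementary1.
rewrite inE negb_or big_cons => /andP[ki kr].
have k0 : unit_mx i k (f i) * (\sum_(j <- r) unit_mx j k (f j)) = 0.
  rewrite mulr_sumr big_seq big1 // => j jr; apply: unit_mxM0.
  by apply: contraNneq kr => ->.
rewrite [X in elementary X](_ : _ =
    (1 + unit_mx i k (f i)) * (1 + \sum_(j <- r) unit_mx j k (f j))).
  by apply: elementaryM; [rewrite eq_sym|exact: IH].
rewrite [RHS](_ : _ = 1 + (unit_mx i k (f i) + \sum_(j <- r) unit_mx j k (f j))
  + unit_mx i k (f i) * (\sum_(j <- r) unit_mx j k (f j))); last by nc_ring.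
by rewrite k0 addr0.
Qed.

End ElementaryMatrices.

(* Both sides equal [1 + x - y]. *)
Lemma vaserstein (R : pzRingType) (x y : R) : x * x = 0 -> y * y = 0 ->
  (1 + x) * (1 + x * y) * (1 - y) = (1 - y) * (1 + y * x) * (1 + x).
Proof.
move=> xx yy.
rewrite [LHS](_ : _ = 1 + x - y + x * x * y * (1 - y) - x * (y * y)); last by nc_ring.
rewrite [RHS](_ : _ = 1 + x - y + y * (x * x) - y * y * x * (1 + x)); last by nc_ring.
by rewrite xx yy !(mul0r, mulr0) subr0 addr0.
Qed.

(** A double coset relation, because the normality of the elementary group is proved only
    afterwards. *)
Definition elementary_equiv (B : pzRingType) (n : nat) (u v : 'M[B]_n) :=
  exists E F, [/\ elementary E, elementary F & u = E * v * F].

Section ElementaryEquiv.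
Variables (B : pzRingType) (n : nat).
Implicit Types (u v w : 'M[B]_n) (a b : 'I_n) (x y : B).

Lemma elementary_equiv_trans u v w :
  elementary_equiv u v -> elementary_equiv v w -> elementary_equiv u w.
Proof.
move=> [E [F [eE eF ->]]] [E' [F' [eE' eF' ->]]].
by exists (E * E'), (F' * F); split; rewrite ?mulrA //; exact: elementary_mul.
Qed.

(** The identity [vaserstein] for [unit_mx a b x] and [unit_mx b a y]; it does not ask [1 + x * y]
    to be invertible. *)
Lemma elementary_equiv_swap a b x y : a != b ->
  elementary_equiv (1 + unit_mx a a (x * y)) (1 + unit_mx b b (y * x)).
Proof.
move=> ab; have ba : b != a by rewrite eq_sym.
have := vaserstein (unit_mxM0 a b x x ba) (unit_mxM0 b a y y ab).
rewrite !unit_mxMM -!unit_mxN => V.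
exists ((1 + unit_mx a b (- x)) * (1 + unit_mx b a (- y))),
  ((1 + unit_mx a b x) * (1 + unit_mx b a y)); split.
- by apply: elementary_mul; exact: elementary_gen.
- by apply: elementary_mul; exact: elementary_gen.
rewrite [RHS](_ : _ = (1 + unit_mx a b (- x)) * ((1 + unit_mx b a (- y))
  * (1 + unit_mx b b (y * x)) * (1 + unit_mx a b x)) * (1 + unit_mx b a y)); last first.
  by rewrite !mulrA.
rewrite -V !mulrA elementary_Vgen // mul1r -mulrA.
by rewrite elementary_Vgen // mulr1.
Qed.

(** When [a = b] one passes through another index [c] and comes back, writing [y * x] as
    [(y * x) * 1]. *)
Lemma elementary_equiv_diag a b x y : (1 < n)%N ->
  elementary_equiv (1 + unit_mx a a (x * y)) (1 + unit_mx b b (y * x)).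
Proof.
move=> n1; have [<-|ab] := eqVneq a b; last exact: elementary_equiv_swap.
have [c ac] : exists c, a != c.
  have [c /negP ca] : exists c : 'I_n, ~ c == a.
    apply/existsNP => H; have := card_ord n.
    rewrite (eq_card (B := pred1 a)) ?card1 => [n1'|c]; first by rewrite -n1' in n1.
    by rewrite !inE (H c).
  by exists c; rewrite eq_sym.
apply: elementary_equiv_trans (elementary_equiv_swap x y ac) _.
have := @elementary_equiv_swap c a (y * x) 1; rewrite mulr1 mul1r; apply.
by rewrite eq_sym.
Qed.

End ElementaryEquiv.

(** * Units of matrix rings: elementary and diagonal factors *)

Section MatrixUnits.
Variables (B : pzRingType) (n : nat) (es : seq B).
Hypothesis n_gt1 : (1 < n)%N.
Hypotheses (oes : orthogonal_idems es) (es1 : \sum_(e <- es) e = 1).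
Implicit Types (u v w : 'M[B]_n) (a b : 'I_n) (e f x y : B).

Let mes : seq 'M[B]_n := [seq unit_mx a a e | a <- enum 'I_n, e <- es].

Lemma unit_mx_mid a b e f u :
  unit_mx a a e * u * unit_mx b b f = unit_mx a b (e * u a b * f).
Proof.
apply/matrixP => i j; rewrite unit_mxMr unit_mxMl unit_mxE.
by case: (i == a); case: (j == b); rewrite ?mul0r.
Qed.

Lemma mx_corner a e u : e * e = e -> corner (unit_mx a a e) u ->
  exists2 x, corner e x & u = unit_mx a a x.
Proof.
move=> ee [eu ue]; exists (e * u a a * e); first exact: corner_mid.
by rewrite -unit_mx_mid eu ue.
Qed.

Lemma unit_mx_exp a x k : unit_mx a a x ^+ k.+1 = unit_mx a a (x ^+ k.+1).
Proof.
elim: k => [|k IH]; first by rewrite !expr1.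
by rewrite exprS IH unit_mxMM -exprS.
Qed.

(** The corner of [unit_mx a a e] in the matrix ring is the corner of [e] in [B]. *)
Lemma unit_mx_local a e : local_idem e -> local_idem (unit_mx a a e).
Proof.
move=> [ee e0 le]; split; first by rewrite unit_mxMM ee.
  apply: contraNneq e0 => /matrixP/(_ a a).
  by rewrite unit_mxE !eqxx mxE mulr1n => ->.
move=> u /(mx_corner ee)[x cx ->]; have [[k xk]|[y [[ey ye] xy yx]]] := le _ cx.
  by left; exists k.+1; rewrite unit_mx_exp exprS xk mulr0 unit_mx0.
by right; exists (unit_mx a a y); rewrite /corner !unit_mxMM ey ye xy yx.
Qed.

Lemma mx_orthogonal : orthogonal_idems mes.
Proof.
have [ues les orth] := oes.
split.
- apply: allpairs_uniq => //; first exact: enum_uniq.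
  move=> [a e] [b f] /allpairsP[[a' e'] /= [_ e'es [-> ->]]].
  move=> /allpairsP[[b' f'] /= [_ f'es [-> ->]]] /=.
  move=> /matrixP/(_ a' a'); rewrite !unit_mxE !eqxx /=.
  have [_ e0 _] := les _ e'es.
  by case: eqP => [->|_ /eqP]; [rewrite mulr1n => ->|rewrite (negbTE e0)].
- by move=> _ /allpairsP[[a e] /= [_ ees ->]]; apply/unit_mx_local/les.
- move=> _ _ /allpairsP[[a e] /= [_ ees ->]] /allpairsP[[b f] /= [_ fes ->]] ef.
  have [ab|/unit_mxM0 -> //] := eqVneq a b; rewrite ab unit_mxMM orth ?unit_mx0 //.
  by apply: contraNneq ef => ->; rewrite ab.
Qed.

Lemma mx_idems_sum1 : \sum_(u <- mes) u = 1.
Proof.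
rewrite big_allpairs_dep /= -[RHS]unit_mx_sum1 big_enum /=.
by apply: eq_bigr => a _; rewrite -scaler_suml es1.
Qed.

(** Elimination along the local idempotents [unit_mx a a e]: transvections between them are
    elementary, and only the normalisation of pivots contributes diagonal factors. *)
Lemma mx_unit_ind (P : 'M[B]_n -> Prop) :
  P 1 -> (forall E u, elementary E -> P (E * u) -> P u) ->
  (forall a e x u, e \in es -> corner e x -> two_sided_unit (1 + unit_mx a a x) ->
    P ((1 + unit_mx a a x) * u) -> P u) ->
  forall u, two_sided_unit u -> P u.
Proof.
move=> P1 PE Pd u; apply: (unit_ind mx_orthogonal mx_idems_sum1 P1) => {u}.
  move=> _ _ u v /allpairsP[[a e] /= [_ ees ->]] /allpairsP[[b f] /= [_ fes ->]].
  move=> ef; rewrite unit_mx_mid; apply: PE.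
  (* For [a = b] the transvection sits on the diagonal. Reversing the product [(e * u a a) * f]
     gives [f * e = 0], so it is elementary equivalent to [1]. *)
  have [ab|ab] := eqVneq a b; last exact: elementary_gen.
  have {}ef : e != f by apply: contraNneq ef => ->; rewrite ab.
  rewrite -ab; have [E [F [eE eF ->]]] := elementary_equiv_diag a a (e * u a a) f n_gt1.
  have [_ _ orth] := oes; rewrite (mulrA f) (orth f e) // 1?eq_sym //.
  by rewrite mul0r unit_mx0 addr0 mulr1; exact: elementary_mul.
move=> _ v w /allpairsP[[a e] /= [_ ees ->]].
have [_ /(_ _ ees)[ee _ _] _] := oes.
by move=> /(mx_corner ee)[x cx ->]; exact: Pd cx.
Qed.

Lemma diag_unitP a x : two_sided_unit (1 + unit_mx a a x) <-> two_sided_unit (1 + x).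
Proof.
split=> [[v [uv vu]]|[y [xy yx]]].
  have one_aa : (1 : 'M[B]_n) a a = 1 by rewrite mxE eqxx.
  exists (v a a); split.
    have /matrixP/(_ a a) := uv; rewrite one_aa => e1; rewrite -[RHS]e1.
    by rewrite !mulrDl !mul1r mxE unit_mxMl eqxx.
  have /matrixP/(_ a a) := vu; rewrite one_aa => e1; rewrite -[RHS]e1.
  by rewrite !mulrDr !mulr1 mxE unit_mxMr eqxx.
have H (p q : B) : (1 + p) * q = 1 -> (1 + unit_mx a a p) * (1 + unit_mx a a (q - 1)) = 1.
  move=> pq.
  rewrite [LHS](_ : _ = 1 + (unit_mx a a p + unit_mx a a (q - 1)
    + unit_mx a a p * unit_mx a a (q - 1))); last by nc_ring.
  rewrite unit_mxMM -!unit_mxD.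
  rewrite (_ : p + (q - 1) + p * (q - 1) = (1 + p) * q - 1); last by nc_ring.
  by rewrite pq subrr unit_mx0 addr0.
exists (1 + unit_mx a a (y - 1)); split; first exact: H.
have := H (y - 1) (1 + x); rewrite [1 + (y - 1)]addrC subrK => /(_ yx).
by rewrite [1 + x - 1]addrAC subrr add0r.
Qed.

(** Conjugation by a diagonal unit sends a generator at [(i, j)] to a generator at [(i, j)]. *)
Lemma elementary_conj_diag a x v E :
  (1 + unit_mx a a x) * v = 1 -> v * (1 + unit_mx a a x) = 1 ->
  elementary E -> elementary (v * E * (1 + unit_mx a a x)).
Proof.
set u := 1 + _ => uv vu.
have /diag_unitP[y [xy yx]] : two_sided_unit u by exists v.
have vE : v = 1 + unit_mx a a (y - 1).
  rewrite -[RHS]mul1r -[X in X * _]vu -mulrA; rewrite [u * _](_ : _ = 1) ?mulr1 // /u.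
  rewrite [LHS](_ : _ = 1 + (unit_mx a a x + unit_mx a a (y - 1)
    + unit_mx a a x * unit_mx a a (y - 1))); last by nc_ring.
  rewrite unit_mxMM -!unit_mxD.
  rewrite (_ : x + (y - 1) + x * (y - 1) = (1 + x) * y - 1); last by nc_ring.
  by rewrite xy subrr unit_mx0 addr0.
elim=> [|i j z {}E ij _ IH]; first by rewrite mulr1 vu; exact: elementary1.
rewrite [X in elementary X](_ : _ = (v * (1 + unit_mx i j z) * u) * (v * E * u)).
  apply: elementary_mul IH; rewrite (mulrDr v 1) mulr1 (mulrDl v) vu vE /u.
  rewrite mulrDl mul1r unit_mxMdl -unit_mxD mulrDr mulr1 unit_mxMdr -unit_mxD.
  exact: elementary_gen.
by rewrite !mulrA -(mulrA _ u v) uv mulr1.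
Qed.

(** Already true for [n = 2], because units are products of elementary and diagonal ones, each of
    which normalises the elementary group. *)
Lemma elementary_normal u v E : u * v = 1 -> v * u = 1 ->
  elementary E -> elementary (u * E * v).
Proof.
move=> uv vu; suff H : forall w, u * w = 1 -> w * u = 1 ->
  forall F, elementary F -> elementary (u * F * w) by exact: H.
have : two_sided_unit u by exists v.
elim/mx_unit_ind : u / {uv vu} => [|G u eG IH|a e x u _ _ [D [uD Du]] IH] w uw wu F eF.
- by rewrite mul1r (_ : w = 1) ?mulr1 // -[w]mul1r.
- have [G' [eG' GG' G'G]] := elementary_inv eG.
  rewrite [X in elementary X](_ : _ = G' * (G * u * F * (w * G')) * G).
    apply: elementary_mul eG; apply: elementary_mul => //; apply: IH => //.
      by rewrite mulrA -(mulrA G) uw mulr1.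
    by rewrite mulrA -(mulrA w) G'G mulr1.
  by rewrite !mulrA G'G mul1r -!mulrA G'G mulr1.
- set G := 1 + _ in uD Du IH *.
  rewrite [X in elementary X](_ : _ = D * (G * u * F * (w * D)) * G).
    apply: elementary_conj_diag => //; apply: IH => //.
      by rewrite mulrA -(mulrA G) uw mulr1.
    by rewrite mulrA -(mulrA w) Du mulr1.
  by rewrite !mulrA Du mul1r -!mulrA Du mulr1.
Qed.

End MatrixUnits.

(** * Finite quotients of orders *)

Section FiniteIndex.
Variables (V : zmodType) (N : nat) (phi : {additive V -> 'rV[rat]_N}).
Hypothesis phi_inj : injective phi.

(** More than [N] vectors of [rat ^ N] are dependent; clearing denominators and dividing by the
    content leaves coefficients without a common prime factor. *)
Lemma int_relation (s : seq V) : (N < size s)%N ->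
  exists2 a : nat -> int, \sum_(i < size s) s`_i *~ a i = 0 &
    forall l, prime l -> exists2 i, (i < size s)%N & ~~ (l %| a i)%Z.
Proof.
move=> sN; pose A := \matrix_(i < size s) phi s`_i.
have : kermx A != 0.
  rewrite kermx_eq0 /row_free neq_ltn; apply/orP; left.
  exact: leq_ltn_trans (rank_leq_col _) sN.
case/rowV0Pn => v /sub_kermxP vA v0.
(* The relation is read as a polynomial, for which content and primitive part are available. *)
have [q [a a0 vq]] := rat_poly_scale (rVpoly v).
have q0 : q != 0.
  apply: contraNneq v0 => q0; rewrite -[v]rVpolyK vq q0 rmorph0 scaler0.
  by apply/eqP/rowP => i; rewrite !mxE coef0.
have sq : (size q <= size s)%N.
  have : size (rVpoly v) = size q.
    by rewrite vq size_scale ?size_rat_int_poly // invr_eq0 intr_eq0.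
  by move=> <-; exact: size_poly.
exists (fun i => (zprimitive q)`_i); last first.
  move=> l pl; apply: contrapT => nex.
  suff : (l %| zcontents (zprimitive q))%Z.
    rewrite zcontents_primitive q0 dvdzE /= dvdn1 => /eqP l1.
    by rewrite l1 in pl.
  rewrite dvdz_contents; apply/polyOverP => i.
  have [si|si] := ltnP i (size s).
    by apply: contrapT => /negP di; apply: nex; exists i.
  by rewrite nth_default ?dvdz0 // size_zprimitive (leq_trans sq).
apply: phi_inj; rewrite raddf0 raddf_sum /=.
have c0 : a%:~R / (zcontents q)%:~R != 0 :> rat.
  by rewrite mulf_neq0 ?invr_eq0 ?intr_eq0 ?zcontents_eq0.
transitivity ((a%:~R / (zcontents q)%:~R) *: (v *m A)); last by rewrite vA scaler0.
rewrite mulmx_sum_row scaler_sumr; apply: eq_bigr => i _; rewrite raddfMz /= rowK scalerA -scaler_int; congr (_ *: _).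
have -> : v 0 i = (rVpoly v)`_i by rewrite coef_rVpoly_ord.
have qi : q`_i = zcontents q * (zprimitive q)`_i by rewrite {1}[q]zpolyEprim coefZ.
rewrite vq coefZ coef_map /= qi [(zcontents q * _)%:~R]intrM; field.
by rewrite !intr_eq0 zcontents_eq0 q0 a0.
Qed.

Variable G : set V.
Hypotheses (G0 : G 0) (GB : forall x y, G x -> G y -> G (x - y)).

Lemma subgroupD x y : G x -> G y -> G (x + y).
Proof. by move=> Gx Gy; rewrite -[y]opprK; apply: GB => //; rewrite -sub0r; exact: GB. Qed.

Lemma subgroupMn x m : G x -> G (x *+ m).
Proof. by move=> Gx; elim: m => [|m IH] //; rewrite mulrS; exact: subgroupD. Qed.

Lemma subgroupMz x (m : int) : G x -> G (x *~ m).
Proof.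
move=> Gx; case: m => m; first exact: subgroupMn.
by rewrite NegzE mulrNz -sub0r; apply: GB => //; exact: subgroupMn.
Qed.

Lemma subgroup_sum (I : Type) (r : seq I) (F : I -> V) : (forall i, G (F i)) ->
  G (\sum_(i <- r) F i).
Proof. by move=> GF; elim/big_ind : _ => // x y; exact: subgroupD. Qed.

Definition finite_index_mul (c : nat) := exists r : seq V, forall x, G x ->
  exists y z, [/\ y \in r, G y, G z & x = y + z *+ c].

(** A family in [G] independent modulo [l G] has at most [N] elements. Adding any [x] to a maximal
    one gives a relation whose coefficient at [x] is prime to [l], so [x] is a combination of the
    family modulo [l G]. *)
Lemma finite_index_prime (l : nat) : prime l -> finite_index_mul l.
Proof.
move=> pl.
pose indep (s : seq V) := (forall x, x \in s -> G x) /\ forall a : nat -> int,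
  (exists2 z, G z & \sum_(i < size s) s`_i *~ a i = z *+ l) ->
  forall i, (i < size s)%N -> (l %| a i)%Z.
have indep_size s : indep s -> (size s <= N)%N.
  move=> [_ ind]; rewrite leqNgt; apply/negP => /int_relation[a sa /(_ _ pl)[i si]].
  by apply/negP/negPn/ind => //; exists 0; rewrite ?mul0rn.
have [s [inds smax]] : exists s, indep s /\ forall x, ~ indep (rcons s x).
  apply: contrapT => nex.
  have : exists2 s, indep s & size s = N.+1.
    elim: N.+1 => [|m [s inds sm]].
      by exists [::] => //; split=> // a _ i.
    have [x ix] : exists x, indep (rcons s x).
      apply: contrapT => nx; apply: nex; exists s; split=> // x ix.
      by apply: nx; exists x.
    by exists (rcons s x); rewrite // size_rcons sm.
  by case=> s /indep_size + sN; rewrite sN ltnn.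
have [Gs ind] := inds; set k := size s.
exists [seq \sum_(i < k) s`_i *+ f i | f : {ffun 'I_k -> 'I_l}] => x Gx.
have Gsi i : G s`_i.
  have [si|si] := ltnP i (size s); first by apply/Gs/mem_nth.
  by rewrite nth_default.
have [a [z Gz sa] ka] : exists2 a : nat -> int, exists2 z, G z &
    \sum_(i < k) s`_i *~ a i + x *~ a k = z *+ l & ~~ (l %| a k)%Z.
  apply: contrapT => nex; apply: (smax x); split.
    by move=> y; rewrite mem_rcons inE => /predU1P[->|/Gs].
  move=> a; rewrite size_rcons big_ord_recr /= nth_rcons ltnn eqxx.
  under eq_bigr => i _ do rewrite nth_rcons ltn_ord.
  move=> [z Gz sa] i; have kl : (l %| a k)%Z.
    by apply: contrapT => /negP kl; apply: nex; exists a => //; exists z.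
  rewrite ltnS leq_eqVlt => /predU1P[->//|]; apply: ind.
  have /dvdzP[b bE] := kl; exists (z - x *~ b); first exact/GB/subgroupMz.
  by rewrite mulrnBl -sa bE mulrzA pmulrn addrK.
have [u [v uv]] : exists u v : int, u * a k + v * l = 1.
  have [u [v uv]] := Bezoutz (a k) l; exists u, v; rewrite uv.
  apply/eqP; rewrite -/(coprimez _ _) coprimezE /= coprime_sym prime_coprime //.
have l0 : (l%:Z != 0) by rewrite -lt0n prime_gt0.
(* As [u] inverts [a k] modulo [l], these are the coefficients of [x] on the family, to be reduced
   to the range below [l]. *)
pose c i := - (u * a i).
have dl i : (`|(c i %% l)%Z| < l)%N.
  by rewrite -ltz_nat gez0_abs ?modz_ge0 // ltz_pmod // ltz_nat prime_gt0.
pose f := [ffun i : 'I_k => Ordinal (dl i)].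
have sE i : s`_i *~ c i = s`_i *+ `|(c i %% l)%Z| + s`_i *~ (c i %/ l)%Z *+ l.
  rewrite pmulrn gez0_abs ?modz_ge0 // pmulrn -mulrzA -mulrzDr addrC.
  by rewrite -divz_eq.
exists (\sum_(i < k) s`_i *+ f i), (z *~ u + x *~ v + \sum_(i < k) s`_i *~ (c i %/ l)%Z).
split.
- by apply/codomP; exists f.
- by apply: subgroup_sum => i; apply: subgroupMn.
- apply: subgroupD; first by apply: subgroupD; exact: subgroupMz.
  by apply: subgroup_sum => i; exact: subgroupMz.
have xE : x = x *~ a k *~ u + x *~ v *+ l.
  by rewrite pmulrn -!mulrzA -mulrzDr [a k * u]mulrC uv.
have cE : \sum_(i < k) s`_i *~ c i = - ((\sum_(i < k) s`_i *~ a i) *~ u).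
  rewrite mulrz_suml -sumrN; apply: eq_bigr => i _.
  by rewrite -mulrzA -mulrNz [a i * u]mulrC.
under eq_bigr => i _ do rewrite ffunE /=.
rewrite !mulrnDl -sumrMnl addrCA -big_split /=.
under eq_bigr => i _ do rewrite -sE.
rewrite cE [LHS]xE [RHS]addrAC; congr (_ + _); rewrite -[z *~ u *+ l](_ : z *+ l *~ u = _); last first.
  by rewrite !pmulrn -!mulrzA mulrC.
by rewrite -sa mulrzDl addrAC subrr add0r.
Qed.

Lemma finite_index (c : nat) : (0 < c)%N -> finite_index_mul c.
Proof.
have [m] := ubnP c; elim: m c => // m IH c; rewrite ltnS => cm c0.
have [c1|c1] := leqP c 1.
  have -> : c = 1%N by apply/eqP; rewrite eqn_leq c1.
  by exists [:: 0] => x Gx; exists 0, x; rewrite inE eqxx add0r.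
have [rp Hp] := finite_index_prime (pdiv_prime c1).
have cE := divnK (pdiv_dvd c).
have [||r Hr] := IH (c %/ pdiv c)%N.
- by rewrite (leq_trans _ cm) // ltn_Pdiv // prime_gt1 ?pdiv_prime.
- by rewrite divn_gt0 ?pdiv_gt0 // dvdn_leq ?pdiv_dvd.
exists [seq y + z *+ pdiv c | y <- rp, z <- r] => x Gx.
have [y [z [yr Gy Gz ->]]] := Hp x Gx; have [y' [z' [yr' Gy' Gz' ->]]] := Hr z Gz.
exists (y + y' *+ pdiv c), z'; split=> //.
- by apply/allpairsP; exists (y, y').
- by apply: subgroupD => //; exact: subgroupMn.
- by rewrite mulrnDl -mulrnA cE addrA.
Qed.

End FiniteIndex.

(** * Clearing denominators with positive integers *)

Section IntegerMultiples.
Variable K : fieldExtType rat.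

Lemma natr_ext_eq0 (c : nat) : ((c%:R : K) == 0) = (c == 0)%N.
Proof. by rewrite -(rmorph_nat (in_alg K)) fmorph_eq0 pnatr_eq0. Qed.

Lemma OKD (x y : K) : OK x -> OK y -> OK (x + y).
Proof. exact: (@integral_add _ _ intr). Qed.

Lemma OK_sum (I : Type) (r : seq I) (F : I -> K) :
  (forall i, OK (F i)) -> OK (\sum_(i <- r) F i).
Proof. by move=> HF; elim/big_ind : _ => //; [exact: OK0|exact: OKD]. Qed.

Lemma OK_horner (p : {poly int}) (x : K) : OK x -> OK (map_poly intr p).[x].
Proof.
move=> Ox; rewrite horner_coef; apply: OK_sum => i; rewrite coef_map /=.
by apply: OKM; [exact: OK_int|exact: OKX].
Qed.

(** Removing the factors [X] from a monic relation for [x] leaves a nonzero constant term, which [x]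
    divides. *)
Lemma OK_divides_nat (x : K) : OK x -> x != 0 ->
  exists2 y, OK y & exists2 c, (0 < c)%N & y * x = c%:R.
Proof.
move=> Ox x0; have [p /monic_neq0] := Ox.
elim/poly_ind: p => [|p c IH]; first by rewrite eqxx.
rewrite rootE rmorphD rmorphM /= map_polyX map_polyC /= hornerMXaddC.
have [-> |c0 _ /eqP] := eqVneq c 0.
  rewrite !addr0 => pX0; rewrite mulf_eq0 (negbTE x0) orbF; apply: IH.
  by apply: contraNneq pX0 => ->; rewrite mul0r.
move=> px.
have c0' : (0 < `|c|)%N by rewrite absz_gt0.
(* The relation reads [p(x) * x = - c]; the sign turns the multiple into the natural number
   [|c|]. *)
exists ((map_poly intr p).[x] * (- Num.sg c)%:~R).
  by apply: OKM; [exact: OK_horner|exact: OK_int].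
exists `|c|%N => //.
rewrite mulrAC (_ : _ * x = - c%:~R); last by apply/eqP; rewrite -addr_eq0 px.
by rewrite rmorphN mulrNN -rmorphM /= mulrC -normrEsg -abszE.
Qed.

Lemma OK_natmul (x : K) : exists2 c, (0 < c)%N & OK (x *+ c).
Proof.
have [d Od [d0 Odx]] := OK_frac x.
have [y Oy [c c0 yd]] := OK_divides_nat Od d0.
by exists c; rewrite // -mulr_natl -yd -mulrA; exact: OKM.
Qed.

Lemma OKMn (x : K) c : OK x -> OK (x *+ c).
Proof.
by move=> Ox; rewrite -mulr_natl; apply: OKM => //; rewrite pmulrn; exact: OK_int.
Qed.

Lemma common_multiple (I : finType) (P : I -> nat -> Prop) :
  (forall i c d, P i c -> P i (c * d)%N) ->
  (forall i, exists2 c, (0 < c)%N & P i c) ->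
  exists2 c, (0 < c)%N & forall i, P i c.
Proof.
move=> Pmul H; have [f Hf] : {f : I -> nat & forall i, (0 < f i)%N /\ P i (f i)}.
  apply: (@choice _ _ (fun i c => (0 < c)%N /\ P i c)) => i.
  by have [c] := H i; exists c.
exists (\prod_i f i)%N => [|i]; first by apply: prodn_gt0 => i; case: (Hf i).
by rewrite (bigD1 i) //=; apply: Pmul; case: (Hf i).
Qed.

End IntegerMultiples.

Section Coordinates.
Variables (K : fieldExtType rat) (Om : falgType K).

(** Coordinates over [K], then over [rat]; finiteness of [L / c L] uses only that this map is
    additive and injective. *)
Definition rat_coord (x : Om) : 'rV[rat]_(\dim {:Om} * \dim {:K}) :=
  mxvec (\matrix_(i, j) coord (vbasis {:K}) j (coord (vbasis {:Om}) i x)).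

Fact rat_coord_is_zmod_morphism : zmod_morphism rat_coord.
Proof.
move=> x y; rewrite /rat_coord -raddfB; congr mxvec.
by apply/matrixP => i j; rewrite !mxE !raddfB.
Qed.

HB.instance Definition _ := GRing.isZmodMorphism.Build Om _ rat_coord
  rat_coord_is_zmod_morphism.

Lemma rat_coord_inj : injective rat_coord.
Proof.
move=> x y /(can_inj mxvecK)/matrixP xy.
rewrite (coord_vbasis (memvf x)) (coord_vbasis (memvf y)).
apply: eq_bigr => i _; congr (_ *: _).
rewrite (coord_vbasis (memvf (coord _ i x))) (coord_vbasis (memvf (coord _ i y))).
by apply: eq_bigr => j _; have := xy i j; rewrite !mxE => ->.
Qed.

End Coordinates.

Section OrderTheory.
Variables (K : fieldExtType rat) (Om : falgType K) (L : set Om) (HL : is_order L).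

Lemma order0 : L 0.
Proof. by rewrite -(subrr 1); apply: (orderB HL); exact: (order1 HL). Qed.

Lemma orderD x y : L x -> L y -> L (x + y).
Proof. exact: (subgroupD order0 (orderB HL)). Qed.

Lemma orderN x : L x -> L (- x).
Proof. by move=> Lx; rewrite -sub0r; apply: (orderB HL) Lx; exact: order0. Qed.

Lemma orderMn x c : L x -> L (x *+ c).
Proof. exact: (subgroupMn order0 (orderB HL)). Qed.

Lemma order_sum (I : Type) (r : seq I) (F : I -> Om) :
  (forall i, L (F i)) -> L (\sum_(i <- r) F i).
Proof. exact: (subgroup_sum order0 (orderB HL)). Qed.

Lemma order_finite_index c : (0 < c)%N -> finite_index_mul L c.
Proof. exact: (finite_index (@rat_coord_inj K Om) order0 (orderB HL)). Qed.

Lemma order_natmul (x : Om) : exists2 c, (0 < c)%N & L (x *+ c).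
Proof.
have [s Ls sfull] := order_span HL.
have : x \in <<in_tuple s>>%VS by rewrite /= sfull memvf.
move=> /coord_span ->.
have [||c c0 Hc] := @common_multiple 'I_(size s)
  (fun i c => OK (coord (in_tuple s) i x *+ c)).
- by move=> i c d; rewrite mulrnA; exact: OKMn.
- by move=> i; exact: OK_natmul.
exists c => //; rewrite -sumrMnl; apply: order_sum => i.
rewrite scalerMnl; apply: (orderZ HL) (Hc i) _; apply: Ls.
by rewrite mem_nth // size_tuple.
Qed.

End OrderTheory.

(** * The finite ring [L / c L] *)

Section IdealQuotient.
Variables (A : pzRingType) (I : set A).

Definition two_sided_ideal := [/\ I 0, forall x y, I x -> I y -> I (x - y),
  forall a x, I x -> I (a * x) & forall a x, I x -> I (x * a)].

Hypothesis idI : two_sided_ideal.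

(* With [I] as the only basic neighbourhood of [0], a Cauchy sequence is one that
   is eventually constant modulo [I], so the completion is [A / I]. *)
Definition ideal_topology : ring_topology A.
Proof.
refine (@RingTopology A [set I] _ _ _ _ _ _ _); first by exists I.
all: case: idI => I0 IB IMl IMr.
- by move=> _ ->.
- by move=> _ _ -> ->; exists I.
- by move=> _ ->; exists I.
- by move=> _ ->; exists I => // x y Ix _; exact: IMr.
- by move=> a _ ->; exists I => // x; exact: IMl.
- by move=> a _ ->; exists I => // x; exact: IMr.
Defined.

Definition ideal_quotient : pzRingType := completion ideal_topology.

End IdealQuotient.

Section ToCompletion.
Variables (A : pzRingType) (T : ring_topology A).

Lemma to_completionD (x y : A) :
  to_completion T (x + y) = to_completion T x + to_completion T y.
Proof.
by rewrite /to_completion -pi_completionD; congr (\pi _); apply: val_inj; rewrite rmorphD.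
Qed.

Lemma to_completionM (x y : A) :
  to_completion T (x * y) = to_completion T x * to_completion T y.
Proof.
apply/esym; apply: etrans (completion_mulE _ _) _; congr (\pi _).
by apply: val_inj; rewrite rmorphM.
Qed.

Lemma to_completion1 : to_completion T 1 = 1.
Proof. by rewrite /to_completion; congr (\pi _); apply: val_inj; rewrite rmorph1. Qed.

Lemma to_completion0 : to_completion T 0 = 0.
Proof. by apply: (addrI (to_completion T 0)); rewrite -to_completionD !addr0. Qed.

End ToCompletion.

Section OrderQuotient.
Variables (K : fieldExtType rat) (Om : falgType K) (L : set Om).

Definition order_pred (HL : is_order L) : {pred Om} := fun x => `[< L x >].

Fact order_pred_subring HL : subring_closed (order_pred HL).
Proof.
split=> [|x y /asboolP Lx /asboolP Ly|x y /asboolP Lx /asboolP Ly];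
  apply/asboolP; [exact: (order1 HL)|exact: (orderB HL)|exact: (orderM HL)].
Qed.

HB.instance Definition _ HL :=
  GRing.isSubringClosed.Build Om (order_pred HL) (order_pred_subring HL).

Record order_ring (HL : is_order L) :=
  OrderElt { order_val :> Om; order_valP : order_val \in order_pred HL }.

HB.instance Definition _ HL := [isSub for @order_val HL].
HB.instance Definition _ HL := [Choice of order_ring HL by <:].
HB.instance Definition _ HL := GRing.SubChoice_isSubPzRing.Build
  Om (order_pred HL) (order_ring HL) (order_pred_subring HL).

(* [pi] is only meaningful on [L]. *)
Record order_reduction (c : nat) (B : pzRingType) (pi : Om -> B) : Prop := OrderReduction {
  reductionD : forall x y, L x -> L y -> pi (x + y) = pi x + pi y;
  reductionM : forall x y, L x -> L y -> pi (x * y) = pi x * pi y;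
  reduction1 : pi 1 = 1;
  reduction_eq0 : forall x, L x -> pi x = 0 <-> exists2 y, L y & x = y *+ c;
  reduction_surj : forall b, exists2 x, L x & pi x = b;
  reduction_fin : exists s : seq B, forall b, b \in s
}.

Lemma order_reduction_exists (HL : is_order L) c : (0 < c)%N ->
  exists (B : pzRingType) (pi : Om -> B), order_reduction c pi.
Proof.
move=> c0; pose A : pzRingType := order_ring HL.
pose I : set A := [set x | exists y : A, x = y *+ c].
have idI : two_sided_ideal I.
  split; first by exists 0; rewrite mul0rn.
  - by move=> _ _ [x ->] [y ->]; exists (x - y); rewrite mulrnBl.
  - by move=> a _ [x ->]; exists (a * x); rewrite mulrnAr.
  - by move=> a _ [x ->]; exists (x * a); rewrite mulrnAl.
pose T := ideal_topology idI.
(* Outside [L] the reduction takes the value of the default [0]. *)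
pose pi (x : Om) : ideal_quotient idI := to_completion T (insubd (0 : A) x).
have insubE x (Lx : L x) : insubd (0 : A) x = OrderElt (introT (asboolP _) Lx) :> A.
  by apply: val_inj; rewrite insubdK //; apply/asboolP.
have Lval (x : A) : L (val x) by apply/asboolP/(valP x).
have valK (x : A) : insubd (0 : A) (val x) = x by rewrite valKd.
have surj (b : ideal_quotient idI) : exists2 x, L x & pi x = b.
  have [s ->] := completionP b; have /asboolP/(_ I erefl)[N HN] := valP s.
  exists (val (val s N)); first exact: Lval.
  rewrite /pi valK; apply/pi_completionP/asboolP => _ ->.
  by exists N => i Ni /=; exact: HN.
exists (ideal_quotient idI), pi; split=> //.
- move=> x y Lx Ly; rewrite -to_completionD; congr to_completion.
  by apply: val_inj; rewrite !insubE //; exact: orderD.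
- move=> x y Lx Ly; rewrite -to_completionM; congr to_completion.
  by apply: val_inj; rewrite !insubE //; exact: (orderM HL).
- rewrite -(to_completion1 T); congr to_completion.
  by apply: val_inj; rewrite insubE //; exact: (order1 HL).
- move=> x Lx; rewrite /pi -(to_completion0 T); split.
    move=> /pi_completionP/asboolP/(_ I erefl)[N /(_ N (leqnn N))[y yE]].
    exists (val y); first exact: Lval.
    have {}yE : insubd (0 : A) x = y *+ c.
      by rewrite -yE rmorphB; exact/esym/subr0.
    by have := congr1 val yE; rewrite insubE // rmorphMn.
  move=> [y Ly xE]; apply/pi_completionP/asboolP => _ ->; exists 0%N => i _.
  exists (insubd (0 : A) y); rewrite rmorphB; apply: etrans (subr0 _) _.
  by apply: val_inj; rewrite rmorphMn !insubE.
have [r Hr] := order_finite_index HL c0; exists (map pi r) => b.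
have [x Lx <-] := surj b; have [y [z [yr Ly Lz xE]]] := Hr x Lx.
apply/mapP; exists y => //; apply/pi_completionP/asboolP => _ ->.
exists 0%N => i _; exists (insubd (0 : A) z); rewrite rmorphB.
apply: val_inj; apply: etrans (rmorphB _ (insubd 0 x) (insubd 0 y)) _.
by rewrite rmorphMn !insubE //= xE addrAC subrr add0r.
Qed.

End OrderQuotient.

(** * Invertibility of two-sided ideals of maximal orders *)

Section LocalWords.
Variables (B : pzRingType) (s : seq B) (Bfin : forall x, x \in s).
Variables (J : set B) (e : B).
Hypotheses (JM : forall a b x, J x -> J (a * x * b)) (le : local_idem e) (eJ : ~ J e).

(** The product [e * j_1 * e * j_2 * ... * e * j_k * y], left open at its right end. *)
Definition word (js : seq B) (y : B) := foldr (fun j acc => e * j * acc) y js.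

Lemma wordMr js x y : word js (x * y) = word js x * y.
Proof. by elim: js => //= j js ->; rewrite mulrA. Qed.

Lemma word_cat js1 js2 : word (js1 ++ js2) e = word js1 e * word js2 e.
Proof.
have [ee _ _] := le; elim: js1 => [|j js1 IH] /=; last by rewrite IH mulrA.
by case: js2 => [|j js2] /=; rewrite ?ee // !mulrA ee.
Qed.

Lemma word_corner js : corner e (word js e).
Proof.
have [ee _ _] := le; split; first by case: js => [|j js] //=; rewrite !mulrA ee.
by rewrite -wordMr ee.
Qed.

(** This element of the corner lies in [J]; were it a unit, [e] would lie in [J]. *)
Lemma word_nilpotent j js : J j -> nilpotent_elt (word (j :: js) e).
Proof.
move=> Jj; have [_ _ /(_ _ (word_corner (j :: js)))[//|[y [_ wy _]]]] := le.
by case: eJ; rewrite -wy /= -(mulrA (e * j)); exact: JM.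
Qed.

(** Two prefixes of a long word coincide, so a prefix is unchanged by right multiplication with a
    nilpotent word, hence is [0]. *)
Lemma word_eq0 js : {in js, forall j, J j} -> (size s < size js)%N -> word js e = 0.
Proof.
move=> Jjs sjs.
have [i [k [ik ks wik]]] := pigeonhole Bfin (fun i => word (take i js) e).
have kjs : (k < size js)%N := leq_ltn_trans ks sjs.
have tk : take k js = take i js ++ drop i (take k js).
  by rewrite -{1}(cat_take_drop i (take k js)) take_takel // ltnW.
have := sjs; case m : (drop i (take k js)) tk => [|j js'] tk _.
  have /(congr1 size) := tk; rewrite cats0 !size_take (ltn_trans ik kjs) kjs.
  by move=> ki; rewrite ki ltnn in ik.
have Jj : J j.
  have : j \in take k js by rewrite tk mem_cat mem_head orbT.
  by move/mem_take; exact: Jjs.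
move: wik; rewrite tk word_cat => wik; have [r wr] := word_nilpotent js' Jj.
have w0 : word (take i js) e = 0.
  have H q : word (take i js) e = word (take i js) e * word (j :: js') e ^+ q.
    by elim: q => [|q IH]; rewrite ?expr0 ?mulr1 // exprSr mulrA -IH -wik.
  by rewrite (H r) wr mulr0.
by rewrite -(cat_take_drop i js) word_cat w0 mul0r.
Qed.

(* Erasing the letters of [J] one at a time from a vanishing word would leave a
   power of [e]. *)
Lemma cyclic_annihilator_false :
  (forall (X : set B) a, (forall b x c, X x -> X (b * x * c)) ->
    (forall j x, J j -> X x -> a * j * x = 0) -> forall x, X x -> x * a = 0) ->
  False.
Proof.
move=> rule; have [ee e0 _] := le.
(* Each step enlarges the set of admissible endings and shortens the vanishing words by one letter;
   at the end the empty word with ending [e] gives [e = 0]. *)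
suff H k : exists Y : set B, [/\ forall b x c, Y x -> Y (b * x * c), Y e &
    forall js y, {in js, forall j, J j} -> size js = ((size s).+1 - k)%N ->
      Y y -> word js y = 0].
  have [Y [_ Ye HY]] := H (size s).+1.
  by case/eqP: e0; apply: (HY [::]); rewrite ?subnn.
elim: k => [|k [Y [YM Ye HY]]].
  (* Initially the endings are [b * e * c]: the factor [b] merges into the last letter, leaving a
     word too long to be nonzero. *)
  exists [set x | exists b c, x = b * e * c]; split.
  - by move=> b _ c [b' [c' ->]]; exists (b * b'), (c' * c); rewrite !mulrA.
  - by exists 1, 1; rewrite mul1r mulr1.
  - move=> js y; case/lastP: js => [|js j] Jjs; first by rewrite subn0.
    rewrite subn0 => sjs [b [c ->]]; rewrite wordMr /word foldr_rcons -/(word _ _).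
    rewrite mulrA -(mulrA e).
    rewrite (_ : word js _ = word (rcons js (j * b)) e); last first.
      by rewrite /word foldr_rcons.
    rewrite word_eq0 ?mul0r ?size_rcons -?(size_rcons js j) ?sjs //.
    move=> i; rewrite mem_rcons inE => /predU1P[->|ijs].
      by rewrite -[j]mul1r; apply/JM/Jjs; rewrite mem_rcons mem_head.
    by apply: Jjs; rewrite mem_rcons inE ijs orbT.
exists [set x | exists b y c, Y y /\ x = y * b * e * c]; split.
- move=> b _ c [b' [y [c' [Yy ->]]]]; exists b', (b * y), (c' * c).
  by split; [rewrite -[_ * _]mulr1; exact: YM|rewrite !mulrA].
- by exists 1, e, 1; rewrite !mulr1 ee.
- move=> js _ Jjs sjs [b [y [c [Yy ->]]]]; rewrite !wordMr.
  have [ks|sk] := ltnP k (size s).+1; last first.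
    have : word js y = 0.
      by apply: HY => //; rewrite sjs; lia.
    by move=> ->; rewrite !mul0r.
  (* The rule with [a := e]: prefixing [e * j] to a multiple of the shorter word gives a word with
     one more letter, which vanishes; so the shorter word vanishes once [b * e] follows it. *)
  rewrite (rule [set x | exists b' c', x = b' * word js y * c'] e) ?mul0r //.
  + by move=> b1 _ c1 [b' [c' ->]]; exists (b1 * b'), (c' * c1); rewrite !mulrA.
  + move=> j _ Jj [b' [c' ->]].
    rewrite mulrA mulrA -(mulrA e) -[e * _ * word _ _]/(word (j * b' :: js) y).
    rewrite HY ?mul0r //=; last by rewrite sjs subSS subSn.
    move=> i; rewrite inE => /predU1P[->|]; last exact: Jjs.
    by rewrite -[j]mul1r; exact: JM.
  + by exists 1, b; rewrite mul1r.
Qed.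

End LocalWords.

Section Reduction.
Variables (K : fieldExtType rat) (Om : falgType K) (L : set Om) (HL : is_order L).
Variables (c : nat) (B : pzRingType) (pi : Om -> B).
Hypothesis red : order_reduction L c pi.

Lemma reduction0 : pi 0 = 0.
Proof.
have L0 := order0 HL; apply: (addrI (pi 0)).
by rewrite -(reductionD red) // !addr0.
Qed.

Lemma reductionN x : L x -> pi (- x) = - pi x.
Proof.
move=> Lx; apply: (addrI (pi x)).
by rewrite -(reductionD red) ?subrr ?reduction0 //; exact: orderN.
Qed.

Lemma reductionB x y : L x -> L y -> pi (x - y) = pi x - pi y.
Proof.
by move=> Lx Ly; rewrite (reductionD red) ?reductionN //; exact: orderN.
Qed.

Lemma reduction_eq x y : L x -> L y -> pi x = pi y -> exists2 z, L z & x = y + z *+ c.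
Proof.
move=> Lx Ly xy; have Lxy := orderB HL Lx Ly.
have /(reduction_eq0 red Lxy)[z Lz zE] : pi (x - y) = 0.
  by rewrite reductionB // xy subrr.
by exists z => //; rewrite -zE addrC subrK.
Qed.

Lemma eq_reduction x y z : L y -> L z -> x = y + z *+ c -> pi x = pi y.
Proof.
move=> Ly Lz ->; have Lzc := orderMn HL c Lz.
rewrite (reductionD red) // [X in _ + X](_ : _ = 0) ?addr0 //.
by apply/(reduction_eq0 red) => //; exists z.
Qed.

Lemma reductionMn x m : L x -> pi (x *+ m) = pi x *+ m.
Proof.
move=> Lx; elim: m => [|m IH]; first by rewrite !mulr0n reduction0.
by rewrite !mulrS (reductionD red) ?IH //; exact: orderMn.
Qed.

End Reduction.

Inductive additive_span (V : nmodType) (S : set V) : set V :=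
| additive_span0 : additive_span S 0
| additive_spanD x y : S x -> additive_span S y -> additive_span S (x + y).

Lemma additive_span_gen (V : nmodType) (S : set V) x : S x -> additive_span S x.
Proof. by move=> Sx; rewrite -[x]addr0; apply: additive_spanD => //; exact: additive_span0. Qed.

Lemma additive_span_add (V : nmodType) (S : set V) x y :
  additive_span S x -> additive_span S y -> additive_span S (x + y).
Proof.
move=> Sx Sy; elim: Sx => [|a b Sa _ IH]; first by rewrite add0r.
by rewrite -addrA; exact: additive_spanD.
Qed.

Lemma additive_span_map (V W : nmodType) (S : set V) (T : set W) (f : V -> W) :
  f 0 = 0 -> {morph f : x y / x + y} -> (forall x, S x -> additive_span T (f x)) ->
  forall x, additive_span S x -> additive_span T (f x).
Proof.
move=> f0 fD ST x; elim=> [|a b Sa _ IH]; first by rewrite f0; exact: additive_span0.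
by rewrite fD; apply: additive_span_add => //; exact: ST.
Qed.

Lemma additive_span_sub (V : nmodType) (S P : set V) : P 0 -> (forall x y, P x -> P y -> P (x + y)) ->
  S `<=` P -> additive_span S `<=` P.
Proof. by move=> P0 PD SP x; elim=> // a b /SP Pa _ Pb; exact: PD. Qed.

(** * Right orders and inverse ideals *)

Section MaximalOrders.
Variables (K : fieldExtType rat) (Om : falgType K) (L : set Om).

Lemma mulrn_falg_inj c (x y : Om) : (0 < c)%N -> x *+ c = y *+ c -> x = y.
Proof.
move=> c0 /eqP; rewrite -subr_eq0 -mulrnBl -scaler_nat scaler_eq0 natr_ext_eq0.
by rewrite eqn0Ngt c0 /= subr_eq0 => /eqP.
Qed.

Lemma divn_falg c (x : Om) : (0 < c)%N -> exists y : Om, x = y *+ c.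
Proof.
move=> c0; exists ((c%:R : K)^-1 *: x).
by rewrite -scaler_nat scalerA mulfV ?scale1r // natr_ext_eq0 -lt0n.
Qed.

Definition OK_span (gs : seq Om) : set Om := [set x | exists a : nat -> K,
  (forall i, OK (a i)) /\ x = \sum_(i < size gs) a i *: gs`_i].

Lemma OK_span_mem gs x : x \in gs -> OK_span gs x.
Proof.
move=> xgs; exists (fun i => (i == index x gs)%:R); split=> [i|].
  by case: eqP => _; [exact: OK1|exact: OK0].
have ix : (index x gs < size gs)%N by rewrite index_mem.
rewrite (bigD1 (Ordinal ix)) //= eqxx scale1r nth_index // big1 ?addr0 // => i ne.
by rewrite (negbTE ne : (_ == index x gs) = false) scale0r.
Qed.

Lemma OK_spanD gs x y : OK_span gs x -> OK_span gs y -> OK_span gs (x + y).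
Proof.
move=> [a [Oa ->]] [b [Ob ->]]; exists (fun i => a i + b i); split=> [i|].
  exact: OKD.
by rewrite -big_split; apply: eq_bigr => i _; rewrite scalerDl.
Qed.

Lemma OK_spanZ gs k x : OK k -> OK_span gs x -> OK_span gs (k *: x).
Proof.
move=> Ok [a [Oa ->]]; exists (fun i => k * a i); split=> [i|]; first exact: OKM.
by rewrite scaler_sumr; apply: eq_bigr => i _; rewrite scalerA.
Qed.

(** Only finite generation needs an argument: [L' / L] embeds in the finite group [L / c L] by
    multiplication by [c], so generators of [L] and finitely many elements of [L'] suffice. *)
Lemma overorder_is_order (L' : set Om) c : is_order L -> (0 < c)%N ->
  L `<=` L' -> (forall x, L' x -> L (x *+ c)) ->
  (forall x y, L' x -> L' y -> L' (x - y)) ->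
  (forall x y, L' x -> L' y -> L' (x * y)) ->
  (forall a x, OK a -> L' x -> L' (a *: x)) -> is_order L'.
Proof.
move=> HL c0 LL' L'c L'B L'M L'Z; split=> //; first exact/LL'/(order1 HL).
- have [m [g [Lg Hg]]] := order_fg HL; have [r Hr] := order_finite_index HL c0.
  (* For a representative [y], [f y] is an element of [L'] whose multiple by [c] is [y] modulo
     [c L], if there is one, and [0] otherwise. *)
  have [f Hf] : {f : Om -> Om & forall y, L' (f y) /\
      ((exists2 w, L w & exists2 z, L' z & z *+ c = y + w *+ c) ->
       exists2 w, L w & f y *+ c = y + w *+ c)}.
    apply: (@choice _ _ (fun y z => L' z /\ (_ -> exists2 w, L w & z *+ c = y + w *+ c))) => y.
    have [[w Lw [z L'z zE]]|nex] := pselect (exists2 w, L w &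
      exists2 z, L' z & z *+ c = y + w *+ c).
      by exists z; split=> // _; exists w.
    by exists 0; split=> [|/nex//]; exact/LL'/(order0 HL).
  pose gs := codom g ++ map f r.
  exists (size gs), (fun i => gs`_i); split=> [i|x L'x].
    have : gs`_i \in gs by rewrite mem_nth.
    rewrite mem_cat => /orP[/codomP[j ->]|/mapP[y _ ->]]; first exact/LL'/Lg.
    by case: (Hf y).
  have [y [w [yr Ly Lw xE]]] := Hr _ (L'c _ L'x).
  have [_ []] := Hf y; first by exists w => //; exists x.
  move=> w' Lw' fE.
  have -> : x = f y + (w - w').
    by apply: (mulrn_falg_inj c0); rewrite mulrnDl mulrnBl fE xE -addrA [w' *+ c + _]addrC subrK.
  suff [a [Oa ->]] : OK_span gs (f y + (w - w')) by exists (fun i => a i).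
  apply: OK_spanD; first by apply: OK_span_mem; rewrite mem_cat map_f ?orbT.
  have [a [Oa ->]] := Hg _ (orderB HL Lw Lw').
  elim/big_ind: _ => [|u v|i _]; [|exact: OK_spanD|].
    exists (fun=> 0); split=> [i|]; first exact: OK0.
    by rewrite big1 // => i _; rewrite scale0r.
  apply: OK_spanZ => //; apply: OK_span_mem.
  by rewrite mem_cat codom_f.
- by have [s Ls sE] := order_span HL; exists s => // x /Ls; exact: LL'.
Qed.

(** The right order of [A] contains [L] and, multiplied by [c * d], lies in [L]; it is therefore an
    order and equals [L] by maximality. *)
Lemma right_order_sub (A : set Om) c d : maximal_order L -> (0 < c)%N -> (0 < d)%N ->
  (forall x y, A x -> A y -> A (x - y)) ->
  (forall a x, L a -> A x -> A (a * x)) -> (forall a x, L a -> A x -> A (x * a)) ->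
  A c%:R -> (forall x, A x -> L (x *+ d)) ->
  forall z, (forall x, A x -> A (x * z)) -> L z.
Proof.
move=> [HL Lmax] c0 d0 AB AMl AMr Ac Ad.
pose L' : set Om := [set z | forall x, A x -> A (x * z)].
suff <- : L' = L by [].
apply: Lmax; last by move=> z Lz x Ax; exact: AMr.
apply: (@overorder_is_order L' (c * d)%N HL).
- by rewrite muln_gt0 c0.
- by move=> z Lz x Ax; exact: AMr.
- by move=> z /(_ _ Ac)/Ad; rewrite mulr_natl mulrnA.
- by move=> y z L'y L'z x Ax; rewrite mulrBr; apply: AB; [exact: L'y|exact: L'z].
- by move=> y z L'y L'z x Ax; rewrite mulrA; exact/L'z/L'y.
- move=> a z Oa L'z x Ax; rewrite -scalerAr -[_ * _]mul1r scalerAl.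
  by apply: AMl (L'z _ Ax); apply: (orderZ HL) => //; exact: (order1 HL).
Qed.

Hypothesis maxL : maximal_order L.
Let HL : is_order L := maxL.1.

Section TwoSidedIdeal.
Variables (I : set Om) (c : nat).
Hypotheses (c0 : (0 < c)%N) (Ic : I c%:R) (IL : I `<=` L).
Hypotheses (IB : forall x y, I x -> I y -> I (x - y)).
Hypotheses (IMl : forall a x, L a -> I x -> I (a * x)).
Hypotheses (IMr : forall a x, L a -> I x -> I (x * a)).

Definition ideal_inv : set Om := [set y | forall x, I x -> L (x * y)].

Lemma ideal_invMl a y : L a -> ideal_inv y -> ideal_inv (a * y).
Proof. by move=> La Iy x Ix; rewrite mulrA; apply/Iy/IMr. Qed.

Lemma ideal_invMr a y : L a -> ideal_inv y -> ideal_inv (y * a).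
Proof. by move=> La Iy x Ix; rewrite mulrA; apply: (orderM HL) => //; exact: Iy. Qed.

Lemma ideal_invB x y : ideal_inv x -> ideal_inv y -> ideal_inv (x - y).
Proof. by move=> Ix Iy z Iz; rewrite mulrBr; apply: (orderB HL); [exact: Ix|exact: Iy]. Qed.

Lemma ideal_inv1 : ideal_inv 1.
Proof. by move=> x Ix; rewrite mulr1; exact: IL. Qed.

Lemma ideal_inv_natmul y : ideal_inv y -> L (y *+ c).
Proof. by move=> /(_ _ Ic); rewrite mulr_natl. Qed.

(** The inverse is defined on one side. It works on the other because [z * y * x] is in [I] for all
    [z] in [I], so [y * x] is in the right order of [I]. *)
Lemma ideal_invK x y : I x -> ideal_inv y -> L (y * x).
Proof.
move=> Ix Iy; apply: (right_order_sub maxL c0 (ltn0Sn 0) IB IMl IMr Ic) => [z /IL //|z Iz].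
by rewrite mulrA; apply: IMl => //; exact: Iy.
Qed.

(** Let [J] be the image of [I] in [L / c L]. If the inverse of [I] is contained in [L], maximality
    shows that [a J X = 0] forces [X a = 0]. For [1] outside [I] some local idempotent is outside
    [J], and [cyclic_annihilator_false] gives a contradiction. *)
Lemma proper_ideal_inv : (forall y, ideal_inv y -> L y) -> I 1.
Proof.
move=> invL; apply: contrapT => I1.
have [B [pi red]] := order_reduction_exists HL c0.
have [s Bfin] := reduction_fin red.
have [es [[_ les _] es1]] := local_decomposition Bfin.
pose J : set B := [set b | exists2 x, I x & pi x = b].
have JM a b x : J x -> J (a * x * b).
  move=> [y Iy <-]; have [a' La' <-] := reduction_surj red a.
  have [b' Lb' <-] := reduction_surj red b; exists (a' * y * b').
    by apply/IMr/IMl.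
  by rewrite !(reductionM red) //; [exact: IL|apply: (orderM HL) => //; exact: IL].
have JD x y : J x -> J y -> J (x + y).
  move=> [x' Ix <-] [y' Iy <-]; exists (x' + y'); last by rewrite (reductionD red) //; exact: IL.
  have I0 : I 0 by rewrite -(subrr x'); exact: IB.
  by rewrite -[y']opprK; apply: IB => //; rewrite -sub0r; exact: IB.
have J0 : J 0.
  exists 0; last exact: reduction0 red.
  by rewrite -(subrr c%:R); exact: IB.
have I1' : ~ J 1.
  move=> [x Ix x1]; apply: I1.
  have [|z Lz xE] := reduction_eq HL red (IL Ix) (order1 HL).
    by rewrite x1 (reduction1 red).
  have -> : 1 = x - z *+ c by rewrite xE addrK.
  by apply: IB => //; rewrite -mulr_natr; exact: IMl.
have [e ees eJ] : exists2 e, e \in es & ~ J e.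
  apply: contrapT => nex; apply: I1'; rewrite -es1 big_seq.
  elim/big_ind: _ => // e ees; apply: contrapT => eJ; apply: nex; by exists e.
apply: (cyclic_annihilator_false Bfin JM (les _ ees) eJ) => X a XM aJX x Xx.
have [a0 La0 a0E] := reduction_surj red a; have [x0 Lx0 x0E] := reduction_surj red x.
(* The annihilator of [I X] modulo [c], lifted to a two-sided ideal of [L] containing [c]. *)
pose A : set Om := [set a | L a /\ forall j x, I j -> L x -> X (pi x) ->
  exists2 z, L z & a * j * x = z *+ c].
have Aa0 : A a0.
  split=> // j y Ij Ly Xy; have Lj := IL Ij.
  have La0j := orderM HL La0 Lj.
  apply/(reduction_eq0 red); first exact: (orderM HL).
  rewrite !(reductionM red) // a0E; apply: aJX => //; by exists j.
suff [z Lz zE] : exists2 z, L z & x0 * a0 = z *+ c.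
  by rewrite -a0E -x0E -(reductionM red) //; apply/(reduction_eq0 red); [exact: (orderM HL)|exists z].
(* With [z = x0 * a0 / c], one has [A j z] inside [A] for each [j] in [I]. Hence [j * z] is in the
   right order of [A], which is [L], and [z] is in the inverse of [I]. *)
have [z zE] := divn_falg (x0 * a0) c0; exists z => //.
apply: invL => j Ij.
apply: (@right_order_sub A c 1 maxL c0 _) => //.
- move=> u v [Lu Hu] [Lv Hv]; split=> [|k y Ik Ly Xy]; first exact: (orderB HL).
  have [p Lp pE] := Hu k y Ik Ly Xy; have [q Lq qE] := Hv k y Ik Ly Xy.
  exists (p - q); first exact: (orderB HL).
  by rewrite mulrnBl -pE -qE !mulrBl.
- move=> u v Lu [Lv Hv]; split=> [|k y Ik Ly Xy]; first exact: (orderM HL).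
  have [p Lp pE] := Hv k y Ik Ly Xy; exists (u * p); first exact: (orderM HL).
  by rewrite -!mulrA (mulrA v) pE mulrnAr.
- move=> u v Lu [Lv Hv]; split=> [|k y Ik Ly Xy]; first exact: (orderM HL).
  have [p Lp pE] := Hv (u * k) y (IMl Lu Ik) Ly Xy; exists p => //.
  by rewrite -pE !mulrA.
- split=> [|k y Ik Ly Xy]; first exact/(orderMn HL)/(order1 HL).
  exists (k * y); first by apply: (orderM HL) => //; exact: IL.
  by rewrite -mulrA mulr_natl.
- by move=> u [].
move=> u [Lu Hu]; have [p Lp pE] := Hu j x0 Ij Lx0 (eq_ind_r X Xx x0E).
have -> : u * (j * z) = p * a0.
  apply: (mulrn_falg_inj c0).
  by rewrite -[RHS]mulrnAl -pE -!mulrnAr -zE !mulrA.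
have [La0' Ha0] := Aa0; split=> [|k y Ik Ly Xy]; first exact: (orderM HL).
have [q Lq qE] := Ha0 k y Ik Ly Xy; exists (p * q); first exact: (orderM HL).
by rewrite -!mulrA (mulrA a0) qE mulrnAr.
Qed.

End TwoSidedIdeal.

Section IdealInverse.
Variables (I : set Om) (c : nat).
Hypotheses (c0 : (0 < c)%N) (Ic : I c%:R) (IL : I `<=` L).
Hypotheses (IB : forall x y, I x -> I y -> I (x - y)).
Hypotheses (IMl : forall a x, L a -> I x -> I (a * x)).
Hypotheses (IMr : forall a x, L a -> I x -> I (x * a)).

(** The ideal [I I^-1] contains [c]. If [I I^-1 y] is in [L] then [I^-1 y] is in [I^-1], so [y] is
    in the right order of [I^-1], which is [L]; [proper_ideal_inv] applies. *)
Lemma ideal_inv_span :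
  additive_span [set z | exists x y, [/\ I x, ideal_inv I y & z = x * y]] 1.
Proof.
set S := [set z | _].
have I0 : I 0 by rewrite -(subrr c%:R); exact: IB.
have SN x : additive_span S x -> additive_span S (- x).
  apply: additive_span_map => [|u v|_ [a [b [Ia Ib ->]]]]; rewrite ?oppr0 ?opprD //.
  apply: additive_span_gen; exists (- a), b; rewrite mulNr; split=> //.
  by rewrite -sub0r; exact: IB.
apply: (proper_ideal_inv c0).
- by apply: additive_span_gen; exists c%:R, 1; rewrite mulr1; split=> //; exact: ideal_inv1.
- apply: additive_span_sub; [exact: (order0 HL)|exact: (orderD HL)|].
  by move=> _ [x [y [Ix Iy ->]]]; exact: Iy.
- by move=> x y Sx Sy; apply: additive_span_add => //; exact: SN.
- move=> a x La; apply: additive_span_map => [|u v|_ [u [v [Iu Iv ->]]]]; rewrite ?mulr0 ?mulrDr //.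
  by apply: additive_span_gen; exists (a * u), v; rewrite mulrA; split=> //; exact: IMl.
- move=> a x La; apply: (@additive_span_map _ _ S S (fun x => x * a)) => [|u v|_ [u [v [Iu Iv ->]]]].
  + by rewrite mul0r.
  + by rewrite mulrDl.
  by apply: additive_span_gen; exists u, (v * a); rewrite mulrA; split=> //; exact: ideal_invMr.
move=> y Jy; apply: (@right_order_sub (ideal_inv I) 1 c maxL (ltn0Sn 0) c0).
- exact: ideal_invB.
- by move=> a x; exact: ideal_invMl.
- by move=> a x; exact: ideal_invMr.
- exact: ideal_inv1.
- by move=> x; exact: ideal_inv_natmul.
move=> x Ix z Iz; rewrite mulrA; apply: Jy; apply: additive_span_gen.
by exists z, x.
Qed.

End IdealInverse.

(* [Iv] is the inverse of the two-sided ideal generated by the entries of [M]. *)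
Lemma entries_ideal_inv n (M N : 'M[Om]_n) c : (0 < n)%N -> (0 < c)%N ->
  Mat L M -> Mat L N -> M *m N = (c%:R)%:M -> exists Iv : set Om,
  [/\ forall a y, L a -> Iv y -> Iv (y * a),
      forall y i j, Iv y -> L (M i j * y),
      forall y i j, Iv y -> L (y * M i j) &
      additive_span [set z | exists a y i j, [/\ L a, Iv y & z = a * (M i j * y)]] 1].
Proof.
move=> n0 c0 LM LN MN.
pose S : set Om := [set z | exists a b i j, [/\ L a, L b & z = a * M i j * b]].
pose I := additive_span S.
have IM i j : I (M i j).
  apply: additive_span_gen; exists 1, 1, i, j; rewrite mul1r mulr1.
  by split=> //; exact: (order1 HL).
have IMl a x : L a -> I x -> I (a * x).
  move=> La; apply: additive_span_map => [|u v|_ [u [v [i [j [Lu Lv ->]]]]]]; rewrite ?mulr0 ?mulrDr //.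
  by apply: additive_span_gen; exists (a * u), v, i, j; rewrite !mulrA; split=> //; exact: (orderM HL).
have IMr a x : L a -> I x -> I (x * a).
  move=> La; apply: (@additive_span_map _ _ S S (fun x => x * a)) => [|u v|_ [u [v [i [j [Lu Lv ->]]]]]].
  - by rewrite mul0r.
  - by rewrite mulrDl.
  by apply: additive_span_gen; exists u, (v * a), i, j; rewrite !mulrA; split=> //; exact: (orderM HL).
have IL : I `<=` L.
  apply: additive_span_sub; [exact: (order0 HL)|exact: (orderD HL)|].
  by move=> _ [a [b [i [j [La Lb ->]]]]]; do 2 apply: (orderM HL) => //.
have IB x y : I x -> I y -> I (x - y).
  move=> Ix Iy; apply: additive_span_add => //; rewrite -mulN1r; apply: IMl => //.
  exact/(orderN HL)/(order1 HL).
have Ic : I c%:R.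
  (* The integer [c] is a diagonal entry of [M *m N], a sum of right multiples of entries of [M]. *)
  pose i := Ordinal n0; have /matrixP/(_ i i) := MN; rewrite !mxE eqxx mulr1n => <-.
  elim/big_ind: _ => [|x y|j _]; [exact: additive_span0|exact: additive_span_add|].
  exact: IMr.
exists (ideal_inv I); split.
- by move=> a y; exact: ideal_invMr.
- by move=> y i j; apply; exact: IM.
- by move=> y i j; apply: (ideal_invK c0).
have := ideal_inv_span c0 Ic IL IB IMl IMr.
apply: (@additive_span_map _ _ _ _ id) => // _ [x [y [Ix Iy ->]]].
apply: (@additive_span_map _ _ S _ (fun x => x * y) _ _ _ x Ix) => [|u v|].
- by rewrite mul0r.
- by rewrite mulrDl.
move=> _ [a [b [i [j [La Lb ->]]]]]; apply: additive_span_gen.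
exists a, (b * y), i, j; rewrite !mulrA; split=> //.
exact: ideal_invMl.
Qed.

End MaximalOrders.

(** * Units modulo elementary matrices *)

Lemma map_mulmx_on (A B : pzRingType) (S : set A) (f : A -> B) m n p
    (X : 'M[A]_(m, n)) (Y : 'M[A]_(n, p)) :
  S 0 -> (forall x y, S x -> S y -> S (x + y)) ->
  (forall x y, S x -> S y -> S (x * y)) -> f 0 = 0 ->
  (forall x y, S x -> S y -> f (x + y) = f x + f y) ->
  (forall x y, S x -> S y -> f (x * y) = f x * f y) ->
  (forall i j, S (X i j)) -> (forall i j, S (Y i j)) ->
  map_mx f (X *m Y) = map_mx f X *m map_mx f Y.
Proof.
move=> S0 SD SM f0 fD fM SX SY; apply/matrixP => i j; rewrite !mxE.
suff [] : S (\sum_k X i k * Y k j) /\ f (\sum_k X i k * Y k j) =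
  \sum_k map_mx f X i k * map_mx f Y k j by [].
elim/big_ind2: _ => // [x1 x2 y1 y2 [Sx <-] [Sy <-]|k _].
  by split; [exact: SD|exact: fD].
by split; [exact: SM|rewrite !mxE fM].
Qed.

(** When [z] inverts [1 + x * y] the last term vanishes and [z * x] is a right multiple of [x]. *)
Lemma push_through (R : pzRingType) (x y z : R) :
  z * x = x * (1 - y * z * x) + ((1 + x * y) * z - 1) * x.
Proof. by nc_ring. Qed.

Section MatrixReduction.
Variables (K : fieldExtType rat) (Om : falgType K) (L : set Om) (HL : is_order L).
Variables (c : nat) (B : pzRingType) (pi : Om -> B).
Hypothesis red : order_reduction L c pi.
Variable n : nat.
Implicit Types X Y Z : 'M[Om]_n.

Local Notation mpi := (map_mx pi : 'M[Om]_n -> 'M[B]_n).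

Lemma MatM X Y : Mat L X -> Mat L Y -> Mat L (X *m Y).
Proof.
move=> LX LY i j; rewrite mxE; apply: (order_sum HL) => k.
by apply: (orderM HL); [exact: LX|exact: LY].
Qed.

Lemma MatD X Y : Mat L X -> Mat L Y -> Mat L (X + Y).
Proof. by move=> LX LY i j; rewrite mxE; apply: (orderD HL); [exact: LX|exact: LY]. Qed.

Lemma MatN X : Mat L X -> Mat L (- X).
Proof. by move=> LX i j; rewrite mxE; apply: (orderN HL). Qed.

Lemma MatMn X m : Mat L X -> Mat L (X *+ m).
Proof.
move=> LX i j; elim: m => [|m IH]; first by rewrite mulr0n mxE; exact: (order0 HL).
by rewrite mulrS mxE; exact: (orderD HL).
Qed.

Lemma Mat1 : Mat L (1 : 'M[Om]_n).
Proof. by move=> i j; rewrite mxE; exact: (orderMn HL _ (order1 HL)). Qed.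

Lemma mpiM X Y : Mat L X -> Mat L Y -> mpi (X * Y) = mpi X * mpi Y.
Proof.
apply: map_mulmx_on; [exact: (order0 HL)|exact: (orderD HL)|exact: (orderM HL)| | |].
- exact: (reduction0 HL red).
- exact: (reductionD red).
- exact: (reductionM red).
Qed.

Lemma mpiD X Y : Mat L X -> Mat L Y -> mpi (X + Y) = mpi X + mpi Y.
Proof. by move=> LX LY; apply/matrixP => i j; rewrite !mxE (reductionD red). Qed.

Lemma mpi1 : mpi 1 = 1.
Proof.
apply/matrixP => i j; rewrite !mxE (reductionMn HL red _ (order1 HL)).
by rewrite (reduction1 red).
Qed.

Lemma mpi_surj (u : 'M[B]_n) : exists2 X, Mat L X & mpi X = u.
Proof.
have [f Hf] : {f : B -> Om & forall b, L (f b) /\ pi (f b) = b}.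
  apply: (@choice _ _ (fun b x => L x /\ pi x = b)) => b.
  by have [x] := reduction_surj red b; exists x.
exists (map_mx f u); first by move=> i j; rewrite mxE; case: (Hf (u i j)).
by apply/matrixP => i j; rewrite !mxE; case: (Hf (u i j)).
Qed.

Lemma mpi_eq X Y : Mat L X -> Mat L Y -> mpi X = mpi Y ->
  exists2 Z, Mat L Z & X = Y + Z *+ c.
Proof.
move=> LX LY /matrixP XY.
have [f Hf] : {f : 'I_n * 'I_n -> Om & forall ij, L (f ij) /\
    X ij.1 ij.2 = Y ij.1 ij.2 + f ij *+ c}.
  apply: (@choice _ _ (fun ij z => L z /\ X ij.1 ij.2 = Y ij.1 ij.2 + z *+ c)) => -[i j] /=.
  have [|z Lz zE] := reduction_eq HL red (LX i j) (LY i j); last by exists z.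
  by have := XY i j; rewrite !mxE.
exists (\matrix_(i, j) f (i, j)).
  by move=> i j; rewrite mxE; case: (Hf (i, j)).
apply/matrixP => i j; rewrite mxE.
have [_ /= ->] := Hf (i, j); congr (_ + _).
by elim: (c) => [|m IH]; rewrite ?mulr0n ?mulrS !mxE // IH.
Qed.

Lemma eq_mpi X Y Z : Mat L Y -> Mat L Z -> X = Y + Z *+ c -> mpi X = mpi Y.
Proof.
move=> LY LZ ->; apply/matrixP => i j; rewrite !mxE.
apply: (eq_reduction HL red (LY i j) (LZ i j)); congr (_ + _).
by elim: (c) => [|m IH]; rewrite ?mulr0n ?mulrS !mxE // IH.
Qed.

Lemma elementary_lift u : elementary u -> exists E F,
  [/\ Mat L E, Mat L F, E * F = 1, F * E = 1 & mpi E = u].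
Proof.
elim=> [|a b x v ab _ [E [F [LE LF EF FE Ev]]]].
  by exists 1, 1; split; rewrite ?mulr1 ?mpi1 //; exact: Mat1.
have [y Ly <-] := reduction_surj red x.
have Lu z : L z -> Mat L (unit_mx a b z).
  by move=> Lz i j; rewrite unit_mxE; exact: (orderMn HL).
exists ((1 + unit_mx a b y) * E), (F * (1 + unit_mx a b (- y))); split.
- by apply: MatM => //; apply: MatD; [exact: Mat1|exact: Lu].
- apply: MatM => //; apply: MatD; [exact: Mat1|apply: Lu; exact: (orderN HL)].
- by rewrite mulrA -(mulrA _ E) EF mulr1 elementary_genV.
- by rewrite mulrA -(mulrA F) elementary_Vgen // mulr1.
rewrite mpiM //; last by apply: MatD; [exact: Mat1|exact: Lu].
rewrite mpiD ?mpi1 ?Ev; [|exact: Mat1|exact: Lu].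
congr ((1 + _) * _); apply/matrixP => i j; rewrite mxE !unit_mxE.
exact: (reductionMn HL red).
Qed.

End MatrixReduction.

(** The units [w] that map the right ideal [M * 'M[B]_n] onto itself. *)
Definition mx_stabilizer (B : pzRingType) n (M w : 'M[B]_n) := exists w',
  [/\ w * w' = 1, w' * w = 1, exists x, w * M = M * x & exists y, w' * M = M * y].

Lemma mx_stabilizerM (B : pzRingType) n (M v w : 'M[B]_n) :
  mx_stabilizer M v -> mx_stabilizer M w -> mx_stabilizer M (v * w).
Proof.
move=> [v' [vv' v'v [x vx] [y vy]]] [w' [ww' w'w [z wz] [t wt]]].
exists (w' * v'); split.
- by rewrite mulrA -(mulrA v) ww' mulr1.
- by rewrite mulrA -(mulrA w') v'v mulr1.
- by exists (x * z); rewrite -mulrA wz mulrA vx mulrA.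
- by exists (t * y); rewrite -mulrA vy mulrA wt mulrA.
Qed.

(** * Units as products of an elementary matrix and a stabilizer of [M] *)

Section StabilizerDecomposition.
Variables (K : fieldExtType rat) (Om : falgType K) (L : set Om).
Hypothesis maxL : maximal_order L.
Let HL : is_order L := maxL.1.
Variables (c : nat) (B : pzRingType) (pi : Om -> B).
Hypotheses (c0 : (0 < c)%N) (red : order_reduction L c pi).
Variables (n : nat) (M N : 'M[Om]_n).
Hypotheses (n1 : (1 < n)%N) (LM : Mat L M) (LN : Mat L N).
Hypothesis (MN : M *m N = (c%:R)%:M).

Local Notation mpi := (map_mx pi : 'M[Om]_n -> 'M[B]_n).

(* If [Y] has entries in the inverse of the ideal of [M], then
   [(1 + M Y) M = M (1 + Y M)] with [1 + Y M] integral. *)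
Lemma stabilizer_column (Iv : set Om) k l y :
  (forall a y, L a -> Iv y -> Iv (y * a)) ->
  (forall y i j, Iv y -> L (M i j * y)) -> (forall y i j, Iv y -> L (y * M i j)) ->
  Iv y -> two_sided_unit (1 + pi (M k l * y)) ->
  exists2 w, mx_stabilizer (mpi M) w &
    exists2 E, elementary E & w = E * (1 + unit_mx k k (pi (M k l * y))).
Proof.
move=> IvM MIv IvM' Ivy up; pose f i := pi (M i l * y).
(* With a single nonzero entry in [Y], the matrix [1 + M * Y] differs from the identity only in
   column [k]. *)
have [q [pq qp]] := up; pose Y : 'M[Om]_n := unit_mx l k y.
have LMY : Mat L (M * Y).
  by move=> i j; rewrite unit_mxMr; apply/(orderMn HL)/MIv.
have LYXM X : Mat L X -> Mat L (Y * X * M).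
  move=> LX i j; rewrite -mulrA unit_mxMl; apply: (orderMn HL).
  rewrite mxE mulr_sumr; apply: (order_sum HL) => h; rewrite mulrA.
  exact/IvM'/IvM.
have L1 := @Mat1 _ _ _ HL n.
have wE : mpi (1 + M * Y) = 1 + \sum_i unit_mx i k (f i).
  rewrite (mpiD red) // (mpi1 HL red); congr (_ + _).
  apply/matrixP => i j; rewrite mxE unit_mxMr (reductionMn HL red); last exact: MIv.
  rewrite summxE (bigD1 i) //= big1 ?addr0; first by rewrite unit_mxE eqxx.
  by move=> h hi; rewrite unit_mxE eq_sym (negbTE hi).
pose r := [seq i <- enum 'I_n | i != k].
pose E := 1 + \sum_(i <- r) unit_mx i k (f i * q).
have eE : elementary E by apply: elementary_column; rewrite mem_filter eqxx.
(* The entries of that column off the diagonal are split off by means of the inverse [q] of the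
   diagonal one. *)
have wEd : mpi (1 + M * Y) = E * (1 + unit_mx k k (f k)).
  rewrite wE (bigD1 k) //= [RHS]mulrDl mul1r -[RHS]addrA; congr (_ + _); congr (_ + _).
  rewrite mulr_suml big_filter big_enum_cond /=; apply: eq_bigr => i ik.
  by rewrite mulrDr mulr1 unit_mxMdr eqxx mulr1n -unit_mxD -mulrA -{1}[q]mulr1 -!mulrDr qp mulr1.
exists (mpi (1 + M * Y)); last by exists E.
have [w' [ww' w'w]] : two_sided_unit (mpi (1 + M * Y)).
  rewrite wEd; apply: two_sided_unitM; first exact: elementary_unit.
  by apply/diag_unitP.
have LMY1 := MatD HL L1 LMY; have LYM : Mat L (Y * M).
  by rewrite -[Y]mulr1; exact: LYXM.
exists w'; split=> //.
  exists (mpi (1 + Y * M)); rewrite -!(mpiM HL red) //; last exact: MatD.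
  by rewrite mulrDl mul1r mulrDr mulr1 mulrA.
have [Z LZ Zw'] := mpi_surj red w'.
(* [Y] itself need not be integral, so [push_through] is applied over [Om] to a lift [Z] of the
   inverse; its error term is divisible by [c]. *)
exists (mpi (1 - Y * Z * M)); rewrite -Zw' -!(mpiM HL red) //; last first.
  by apply: MatD => //; apply: MatN => //; exact: LYXM.
have [C LC CE] : exists2 C, Mat L C & (1 + M * Y) * Z = 1 + C *+ c.
  apply: (mpi_eq HL red) => //; first exact: MatM.
  by rewrite (mpiM HL red) // Zw' ww' (mpi1 HL red).
apply: (@eq_mpi _ _ _ HL _ _ _ red _ _ _ (C * M)).
- by apply: MatM => //; apply: MatD => //; apply: MatN => //; exact: LYXM.
- exact: MatM.
rewrite -mulrnAl (_ : C *+ c = (1 + M * Y) * Z - 1); last by rewrite CE addrAC subrr add0r.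
exact: push_through.
Qed.

Let decomposable (u : 'M[B]_n) :=
  exists E w, [/\ elementary E, mx_stabilizer (mpi M) w & u = E * w].

Lemma mx_stabilizer1 : mx_stabilizer (mpi M) 1.
Proof. by exists 1; rewrite !mul1r; split=> //; exists 1; rewrite mulr1. Qed.

(** By [mx_unit_ind] the point is a diagonal unit [1 + x] in a local corner: [x] is factored through
    an entry of [M], and exchanging the factors reduces to [stabilizer_column]. *)
Lemma stabilizer_decomposition (u : 'M[B]_n) : two_sided_unit u ->
  exists E w, [/\ elementary E, mx_stabilizer (mpi M) w & u = E * w].
Proof.
have [s Bfin] := reduction_fin red.
have [es [oes es1]] := local_decomposition Bfin.
have [Iv [IvM MIv IvM' Iv1]] := entries_ideal_inv maxL (ltnW n1) c0 LM LN MN.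
move: u; apply: (mx_unit_ind n1 oes es1) =>
  [|F u eF [E [w [eE sw FuE]]]|a e x u ees [ex xe] ux [E [w [eE sw xuE]]]].
- exists 1, 1; split; rewrite ?mulr1 //; first exact: elementary1.
  exact: mx_stabilizer1.
- have [F' [eF' _ F'F]] := elementary_inv eF.
  exists (F' * E), w; split=> //; first exact: elementary_mul.
  by rewrite -mulrA -FuE mulrA F'F mul1r.
have [_ les _] := oes; have le := les _ ees; have [ee e0 _] := le.
have decE F : elementary F -> decomposable F.
  by exists F, 1; rewrite mulr1; split=> //; exact: mx_stabilizer1.
(* Normality of the elementary group moves the second elementary factor across [w1]. *)
have decM v v' : decomposable v -> decomposable v' -> decomposable (v * v').
  move=> [E1 [w1 [eE1 sw1 ->]]] [E2 [w2 [eE2 sw2 ->]]].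
  have [w1' [ww w'w _ _]] := sw1; exists (E1 * (w1 * E2 * w1')), (w1 * w2); split.
  - by apply: elementary_mul => //; exact: (elementary_normal n1 oes es1).
  - exact: mx_stabilizerM.
  - by rewrite !mulrA -(mulrA _ w1' w1) w'w mulr1.
suff [d' d'd decd'] : exists2 d', d' * (1 + unit_mx a a x) = 1 & decomposable d'.
  have -> : u = d' * ((1 + unit_mx a a x) * u) by rewrite mulrA d'd mul1r.
  by apply: decM => //; exists E, w.
(* As [1] is a sum of products [g * (M i j * y)], locality of the corner makes one of them a unit
   there, with inverse [b]. *)
have [g [y [i [j [Lg Ivy [b [[eb be] gb _]]]]]]] : exists g y i j, [/\ L g, Iv y &
    corner_unit e (e * pi (g * (M i j * y)) * e)].
  have : corner_unit e (e * pi 1 * e).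
    by rewrite (reduction1 red) mulr1 ee; exists e.
  elim: Iv1 => [[b [_ + _]]|z t [g [y [i [j [Lg Ivy zE]]]]] St IH].
    by rewrite (reduction0 HL red) mulr0 !mul0r => e0'; case/eqP: e0.
  have Lz : L z by rewrite zE; apply: (orderM HL) => //; exact: MIv.
  have Lt : L t.
    move: St {IH}; apply: additive_span_sub; [exact: (order0 HL)|exact: (orderD HL)|].
    by move=> _ [g' [y' [i' [j' [Lg' Iy' ->]]]]]; apply: (orderM HL) => //; exact: MIv.
  rewrite (reductionD red) // mulrDr mulrDl.
  case/(corner_unitD le (corner_mid _ ee) (corner_mid _ ee)) => [uz|/IH//].
  by exists g, y, i, j; rewrite -zE.
have [h Lh hE] := reduction_surj red (e * (b * x)).
have [p Lp pE] := reduction_surj red (e * pi g).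
have LMy := MIv _ i j Ivy; have Ivyh := IvM _ _ Lh Ivy; have LMyh := MIv _ i j Ivyh.
(* Here [p] lifts [e * pi g] and [h] lifts [e * b * x]; the inverse [b] gives back [e * x = x]. *)
have xE : x = pi p * pi (M i j * (y * h)).
  rewrite mulrA (reductionM red) // pE hE !mulrA -(mulrA e) -(reductionM red) //.
  by rewrite gb ex.
have Mp : pi (M i j * (y * h)) * pi p = pi (M i j * (y * h * p)).
  by rewrite -(reductionM red) // !mulrA.
(* The exchange moves the unit to row [i], where it becomes [1 + M i j * (y * h * p)], with
   [y * h * p] in the inverse ideal. *)
have [E1 [F1 [eE1 eF1 dE]]] :=
  elementary_equiv_diag a i (pi p) (pi (M i j * (y * h))) n1.
have [E1' [eE1' E11' E1'1]] := elementary_inv eE1.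
have [F1' [eF1' F11' F1'1]] := elementary_inv eF1.
rewrite -xE Mp in dE; set d0 := 1 + unit_mx i i _ in dE.
have ud0 : two_sided_unit d0.
  have -> : d0 = E1' * (1 + unit_mx a a x) * F1'.
    by rewrite dE !mulrA E1'1 mul1r -mulrA F11' mulr1.
  apply: two_sided_unitM; last exact: elementary_unit.
  by apply: two_sided_unitM => //; exact: elementary_unit.
have up0 : two_sided_unit (1 + pi (M i j * (y * h * p))) by apply/(diag_unitP i).
have [w0 sw0 [E2 eE2 w0E]] := stabilizer_column IvM MIv IvM' (IvM _ _ Lp Ivyh) up0.
have [w0' [ww w'w w0x w0y]] := sw0.
exists (F1' * w0' * (E2 * E1')).
  rewrite dE [LHS](_ : _ = F1' * (w0' * (E2 * (E1' * E1 * d0))) * F1); last first.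
    by rewrite !mulrA.
  by rewrite E1'1 mul1r -w0E w'w mulr1.
apply: (decM); last by apply/decE/elementary_mul.
apply: (decM); first exact: decE.
exists 1, w0'; rewrite mul1r; split=> //; first exact: elementary1.
by exists w0.
Qed.

End StabilizerDecomposition.

(** * From local to global equivalence *)

Section PrimeIdeals.
Variable K : fieldExtType rat.

Definition OK_ideal (A : set K) := [/\ A `<=` @OK K, A 0,
  forall x y, A x -> A y -> A (x + y) & forall a x, OK a -> A x -> A (a * x)].

Lemma maximal_ideal_prime (A : set K) : OK_ideal A -> ~ A 1 ->
  (forall C, OK_ideal C -> A `<=` C -> ~ C 1 -> C `<=` A) ->
  forall x y, OK x -> OK y -> A (x * y) -> A x \/ A y.
Proof.
move=> [AO A0 AD AM] A1 Amax x y Ox Oy Axy.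
apply: contrapT => /not_orP[Ax Ay].
pose C : set K := [set z | exists2 m, A m & exists2 r, OK r & z = m + x * r].
have idC : OK_ideal C.
  split.
  - by move=> _ [m Am [r Or ->]]; apply: OKD; [exact: AO|exact: OKM].
  - by exists 0 => //; exists 0; [exact: OK0|rewrite mulr0 addr0].
  - move=> _ _ [m Am [r Or ->]] [m' Am' [r' Or' ->]]; exists (m + m'); first exact: AD.
    by exists (r + r'); [exact: OKD|ring].
  - move=> a _ Oa [m Am [r Or ->]]; exists (a * m); first exact: AM.
    by exists (a * r); [exact: OKM|ring].
have AC : A `<=` C.
  by move=> m Am; exists m => //; exists 0; [exact: OK0|rewrite mulr0 addr0].
have [[m Am [r Or mr]]|C1] := pselect (C 1).
  apply: Ay; rewrite -[y]mul1r mr (_ : _ * y = y * m + r * (x * y)); last by ring.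
  by apply: AD; exact: AM.
apply/Ax/(Amax C idC AC C1); exists 0 => //; exists 1; first exact: OK1.
by rewrite mulr1 add0r.
Qed.

Lemma prime_ideal_containing (A : set K) : OK_ideal A -> ~ A 1 ->
  (exists2 x, A x & x != 0) -> exists p : finite_place K, forall x, A x -> p x.
Proof.
move=> idA A1 [x0 Ax0 x00].
pose P : set (set K) :=
  [set C | C = set0 \/ [/\ OK_ideal C, A `<=` C & ~ C 1]].
have [F FP Ftot|C [PC Cmax]] := @Zorn_bigcup K P.
  have [nF|/existsPNP[C FC C0]] := pselect (forall C, F C -> C = set0).
    by left; rewrite -subset0 => x [C /nF -> ].
  have good D : F D -> D !=set0 -> [/\ OK_ideal D, A `<=` D & ~ D 1].
    by move=> FD [d Dd]; have [D0|//] := FP _ FD; rewrite D0 in Dd.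
  have C0' : C !=set0 by apply/set0P/eqP.
  have [[CO C00 CD CM] AC C1] := good _ FC C0'.
  right; split; first split.
  - by move=> x [D FD Dx]; have [[DO _ _ _] _ _] := good _ FD (ex_intro _ x Dx); exact: DO.
  - by exists C.
  - move=> x y [D FD Dx] [E FE Ey].
    have [[_ _ DD _] _ _] := good _ FD (ex_intro _ x Dx).
    have [[_ _ ED _] _ _] := good _ FE (ex_intro _ y Ey).
    by have [DE|ED'] := Ftot _ _ FD FE; [exists E => //; apply: ED => //; exact: DE
      |exists D => //; apply: DD => //; exact: ED'].
  - move=> a x Oa [D FD Dx]; have [[_ _ _ DM] _ _] := good _ FD (ex_intro _ x Dx).
    by exists D => //; exact: DM.
  - by move=> x Ax; exists C => //; exact: AC.
  - by move=> [D FD D1]; have [_ _ /(_ D1)] := good _ FD (ex_intro _ 1 D1).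
have [C0|[idC AC C1]] := PC.
  exfalso; apply: (Cmax A); last by right; split.
  rewrite C0; split; first exact: sub0set.
  by move=> /(_ x0 Ax0).
have [CO C0 CD CM] := idC.
have Cprime := maximal_ideal_prime idC C1.
have {}Cmax D : OK_ideal D -> C `<=` D -> ~ D 1 -> D `<=` C.
  move=> idD CD' D1; apply: contrapT => DC; apply: (Cmax D); first by split.
  by right; split=> //; exact: subset_trans CD'.
unshelve eexists (@FinitePlace K C CO C0 CD CM C1 (Cprime Cmax) _) => //.
by exists x0 => //; exact: AC.
Qed.

End PrimeIdeals.

(** * Gluing equivalences along central idempotents *)

Section Gluing.
Variables (R : pzRingType) (m m' : R).

(** For a central idempotent [z] this is equivalence in the factor [z R]; for [z = 1] it is
    equivalence by units of [R]. *)
Definition equiv_at (z : R) := exists u u' v v', [/\ z * (u * u') = z,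
  z * (u' * u) = z, z * (v * v') = z, z * (v' * v) = z & z * (u * m * v) = z * m'].

Lemma equiv_atMl y z : equiv_at z -> equiv_at (y * z).
Proof.
move=> [u [u' [v [v' [uu u'u vv v'v mE]]]]]; exists u, u', v, v'.
by split; rewrite -(mulrA y) ?uu ?u'u ?vv ?v'v ?mE ?mulrA.
Qed.

Section Mix.
Variable e : R.
Hypotheses (ee : e * e = e) (ec : forall x, e * x = x * e).

Let mix (a b : R) : R := e * a + (1 - e) * b.

Let mixM a b c d : mix a b * mix c d = mix (a * c) (b * d).
Proof.
rewrite /mix [LHS](_ : _ = e * (a * e) * c + e * a * d - e * (a * e) * d
  + (b * e) * c - e * (b * e) * c + b * d - (b * e) * d - e * b * d
  + e * (b * e) * d); last by nc_ring.
rewrite -!ec !(mulrA e e) ee; nc_ring.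
Qed.

Let mixl a b : e * mix a b = e * a.
Proof. by rewrite /mix (_ : _ * _ = e * e * a + (e - e * e) * b); [rewrite ee subrr mul0r addr0|nc_ring]. Qed.

Let mixr a b : (1 - e) * mix a b = (1 - e) * b.
Proof.
rewrite /mix [LHS](_ : _ = (e - e * e) * a + (1 - e - (e - e * e)) * b); last by nc_ring.
by rewrite ee subrr mul0r add0r subr0.
Qed.

Let mix_eq f a b c : (forall x, f * x = x * f) -> e * a = e * c -> f * b = f * c ->
  (e + (1 - e) * f) * mix a b = (e + (1 - e) * f) * c.
Proof.
move=> fc ac bc; rewrite !(mulrDl e ((1 - e) * f)) mixl ac; congr (_ + _).
by rewrite -(mulrA (1 - e) f (mix a b)) (fc (mix a b)) mulrA mixr -!mulrA -fc bc.
Qed.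

(** Data from [e] are used on [e R] and data from [f] on [(1 - e) R]; [f] is central, not
    necessarily idempotent. *)
Lemma equiv_at_glue f : (forall x, f * x = x * f) ->
  equiv_at e -> equiv_at f -> equiv_at (e + (1 - e) * f).
Proof.
move=> fc [u [u' [v [v' [uu u'u vv v'v uv]]]]] [x [x' [y [y' [xx x'x yy y'y xy]]]]].
exists (mix u x), (mix u' x'), (mix v y), (mix v' y').
have mE : m = mix m m by rewrite /mix; nc_ring.
split; rewrite ?[X in _ * (_ * X * _)]mE !mixM.
1-4: by rewrite -[RHS]mulr1; apply: mix_eq => //; rewrite mulr1.
exact: mix_eq.
Qed.

End Mix.

End Gluing.

(** * Approximating matrices over the completions *)

Section CompletionMatrices.
Variables (A : pzRingType) (T : ring_topology A) (n : nat).
Implicit Types X Y : 'M[cauchy_ring T]_n.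

Local Notation cpi := (fun s : cauchy_ring T => \pi_(completion T) s : completion T).

Lemma map_cpiM X Y : map_mx cpi (X *m Y) = map_mx cpi X *m map_mx cpi Y.
Proof.
apply: (@map_mulmx_on _ _ setT) => //.
- apply: (addrI (cpi 0)); rewrite -[LHS](pi_completionD (T := T)) !addr0 //.
- by move=> x y _ _; exact: pi_completionD.
- by move=> x y _ _; exact/esym/completion_mulE.
Qed.

Lemma map_cpi_eq X Y W : map_mx cpi X = map_mx cpi Y -> nbhs0 T W ->
  exists N, forall k, (N <= k)%N -> forall i j,
    W (cauchy_val (X i j) k - cauchy_val (Y i j) k).
Proof.
move=> /matrixP XY WT.
have [f Hf] : {f : 'I_n * 'I_n -> nat & forall ij k, (f ij <= k)%N ->
    W (cauchy_val (X ij.1 ij.2) k - cauchy_val (Y ij.1 ij.2) k)}.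
  apply: (@choice _ _ (fun ij N => forall k, (N <= k)%N ->
    W (cauchy_val (X ij.1 ij.2) k - cauchy_val (Y ij.1 ij.2) k))) => -[i j] /=.
  have := XY i j; rewrite !mxE => /pi_completionP/asboolP/(_ W WT)[N HN].
  by exists N => k /HN; rewrite rmorphB.
exists (\max_ij f ij)%N => k Nk i j; apply: (Hf (i, j)).
by apply: leq_trans Nk; exact: (leq_bigmax (i, j)).
Qed.

Definition cauchy_at (k : nat) X : 'M[A]_n := map_mx (fun s => cauchy_val s k) X.

Lemma cauchy_atM k X Y : cauchy_at k (X *m Y) = cauchy_at k X *m cauchy_at k Y.
Proof.
by apply: (@map_mulmx_on _ _ setT).
Qed.

Lemma cauchy_lift (L : set A) (U : 'M[completion T]_n) :
  Mat (completion_closure T L) U ->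
  exists2 X : 'M[cauchy_ring T]_n, map_mx cpi X = U & forall k, Mat L (cauchy_at k X).
Proof.
move=> LU; have [f Hf] : {f : 'I_n * 'I_n -> cauchy_ring T & forall ij,
    (forall k, L (cauchy_val (f ij) k)) /\ U ij.1 ij.2 = cpi (f ij)}.
  apply: (@choice _ _ (fun ij s => (forall k, L (cauchy_val s k)) /\
    U ij.1 ij.2 = cpi s)) => -[i j].
  by have [s Ls sE] := LU i j; exists s.
exists (\matrix_(i, j) f (i, j)).
  by apply/matrixP => i j; rewrite !mxE; case: (Hf (i, j)).
by move=> k i j; rewrite !mxE; case: (Hf (i, j)).
Qed.

Definition cauchy_const (X : 'M[A]_n) : 'M[cauchy_ring T]_n :=
  map_mx (fun a => CauchySeq (introT (asboolP _) (@cauchy_cst A T a))) X.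

Lemma cauchy_constE (Z : 'M[A]_n) :
  map_mx cpi (cauchy_const Z) = map_mx (to_completion T) Z.
Proof. by apply/matrixP => i j; rewrite !mxE. Qed.

Lemma cauchy_at_const k (Z : 'M[A]_n) : cauchy_at k (cauchy_const Z) = Z.
Proof. by apply/matrixP => i j; rewrite !mxE. Qed.

End CompletionMatrices.

Section Denominators.
Variables (K : fieldExtType rat) (Om : falgType K) (L : set Om) (HL : is_order L).
Variable p : finite_place K.

Lemma common_denominator (I : finType) (P : I -> K -> Prop) :
  (forall i s t, OK t -> P i s -> P i (t * s)) ->
  (forall i, exists s, [/\ OK s, ~ p s & P i s]) ->
  exists s, [/\ OK s, ~ p s & forall i, P i s].
Proof.
move=> PM H; have [f Hf] := choice H.
have OKp (r : seq I) (Q : pred I) : OK (\prod_(i <- r | Q i) f i).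
  by elim/big_ind: _ => [|x y|i _]; [exact: OK1|exact: OKM|case: (Hf i)].
exists (\prod_i f i); split=> [||i]; first exact: OKp.
  suff [] : OK (\prod_i f i) /\ ~ p (\prod_i f i) by [].
  elim/big_ind: _ => [|x y [Ox px] [Oy py]|i _]; last by case: (Hf i).
    by split; [exact: OK1|exact: prime_ideal1].
  by split; [exact: OKM|exact: nonprimeM].
by rewrite (bigD1 i) //= mulrC; apply: PM; [exact: OKp|case: (Hf i)].
Qed.

(** Closeness in coordinates becomes divisibility by [c] in [L] after multiplication by an integer
    outside [p], the product of the local denominators of the coordinates. *)
Lemma coord_denominator c : (0 < c)%N -> exists2 d : K, d != 0 &
  forall x : Om, coord_nbhs (padic_nbhs p d) x ->
    exists s, [/\ OK s, ~ p s & exists2 z, L z & s *: x = z *+ c].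
Proof.
move=> c0; set b := vbasis {:Om}.
have [||N N0 HN] := @common_multiple 'I_(\dim {:Om}) (fun i N => L (b`_i *+ N)).
- by move=> i c1 c2; rewrite mulrnA; exact: (orderMn HL).
- by move=> i; exact: (order_natmul HL).
(* The factor [N] brings the basis of [Om] into [L]; the factor [c] gives the divisibility. *)
exists (N * c)%:R => [|x Hx]; first by rewrite natr_ext_eq0 -lt0n muln_gt0 N0.
have [||s [Os ps Hs]] := @common_denominator 'I_(\dim {:Om})
  (fun i s => exists2 t, OK t & s * coord b i x = (N * c)%:R * t).
- by move=> i s t Ot [a Oa aE]; exists (t * a); [exact: OKM|rewrite -mulrA aE mulrCA].
- move=> i; have [_ [a [s [Oa Os ps ->]] ->]] := Hx i; exists s; split=> //.
  by exists a; rewrite // mulrCA [s * _]mulrC divfK // (nonprime_neq0 ps).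
exists s; split=> //; have [t Ht] := choice (fun i => (exists2P _ _).1 (Hs i)).
exists (\sum_i t i *: (b`_i *+ N)).
  apply: (order_sum HL) => i; apply: (orderZ HL) (HN i).
  by have [] := Ht i.
rewrite {1}(coord_vbasis (memvf x)) scaler_sumr -sumrMnl; apply: eq_bigr => i _.
have [_ tE] := Ht i; rewrite scalerA tE -scalerA scaler_nat -scalerMnr.
by rewrite mulrnA.
Qed.

End Denominators.

Section LocalEquivalence.
Variables (R : realType) (K : fieldExtType rat) (Om : falgType K) (L : set Om).
Hypothesis HL : is_order L.
Variable n : nat.

Definition at_place (v : place R K) (U : 'M[place_product R Om]_n) :
  'M[local_completion Om v]_n := map_mx (fun x : place_product R Om => x v) U.

Lemma at_placeM v U V : at_place v (U *m V) = at_place v U *m at_place v V.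
Proof. by apply: (@map_mulmx_on _ _ setT). Qed.

Lemma at_place1 v : at_place v 1%:M = 1%:M.
Proof. by apply/matrixP => i j; rewrite !mxE; case: (i == j). Qed.

Lemma adeles_lift (p : finite_place K) U : Mat (integral_adeles L) U ->
  exists2 X : 'M[cauchy_ring (local_topology Om (inl p : place R K))]_n,
    map_mx (fun s => \pi_(completion _) s : completion _) X = at_place (inl p) U
    & forall k, Mat L (cauchy_at k X).
Proof.
move=> LU; apply: cauchy_lift => i j; rewrite mxE.
by have [_] := LU i j; exact.
Qed.

Lemma adele_diag_at_place v (M : 'M[Om]_n) :
  at_place v (map_mx (adele_diag R) M) = map_mx (to_completion _) M.
Proof. by apply/matrixP => i j; rewrite !mxE. Qed.

Variables (p : finite_place K) (c : nat).
Hypothesis c0 : (0 < c)%N.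

(** For [s] outside [p] this is congruence modulo [c] over the localisation of [L] at [p], written
    with its denominator. *)
Definition congr_at (s : K) (P Q : 'M[Om]_n) :=
  exists2 Z, Mat L Z & (s%:A)%:M * P = (s%:A)%:M * Q + Z *+ c.

Lemma near_congr_at d (P Q : 'M[Om]_n) : (forall x : Om, coord_nbhs (padic_nbhs p d) x ->
    exists s, [/\ OK s, ~ p s & exists2 z, L z & s *: x = z *+ c]) ->
  (forall i j, coord_nbhs (padic_nbhs p d) (P i j - Q i j)) ->
  exists s, [/\ OK s, ~ p s & congr_at s P Q].
Proof.
move=> Hd HPQ.
have [||s [Os ps Hs]] := @common_denominator K p ('I_n * 'I_n)%type
  (fun ij s => exists z, L z /\ s *: (P ij.1 ij.2 - Q ij.1 ij.2) = z *+ c).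
- move=> ij s t Ot [z [Lz zE]]; exists (t *: z); split; first exact: (orderZ HL).
  by rewrite -scalerA zE scalerMnr.
- by move=> ij; have [s [Os ps [z Lz zE]]] := Hd _ (HPQ ij.1 ij.2); exists s; split=> //; exists z.
exists s; split=> //; have [f Hf] := choice Hs.
exists (\matrix_(i, j) f (i, j)); first by move=> i j; rewrite mxE; case: (Hf (i, j)).
apply/matrixP => i j; rewrite -!mulmxE !mul_scalar_mx.
have [_ /= fE] := Hf (i, j).
have -> : (\matrix_(i, j) f (i, j) : 'M[Om]_n) *+ c = \matrix_(i, j) (f (i, j) *+ c).
  apply/matrixP => k l; rewrite mxE; elim: (c) => [|m IH].
    by rewrite !mulr0n mxE.
  by rewrite !mulrS !mxE IH.
by rewrite !mxE -fE scalerBr -!scalerAl !mul1r addrC subrK.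
Qed.

Lemma congr_atMl s t P Q : OK t -> congr_at s P Q -> congr_at (t * s) P Q.
Proof.
move=> Ot [Z LZ E]; exists ((t%:A)%:M * Z).
  move=> i j; rewrite -mulmxE mul_scalar_mx mxE -scalerAl mul1r.
  exact: (orderZ HL) Ot (LZ i j).
rewrite (_ : (t * s)%:A%:M = (t%:A)%:M * (s%:A)%:M); last first.
  by rewrite -mulmxE -scalar_mxM -scalerAl mul1r scalerA.
by rewrite -!mulrA E mulrDr mulrnAr.
Qed.

Lemma local_equivalence (M M' : 'M[Om]_n) U V :
  GL (integral_adeles L) U -> GL (integral_adeles L) V ->
  U *m map_mx (adele_diag R) M *m V = map_mx (adele_diag R) M' ->
  exists s, [/\ OK s, ~ p s & exists X X' Y Y',
    [/\ Mat L X, Mat L X', Mat L Y & Mat L Y'] /\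
    [/\ congr_at s (X * X') 1, congr_at s (X' * X) 1, congr_at s (Y * Y') 1,
        congr_at s (Y' * Y) 1 & congr_at s (X * M * Y) M']].
Proof.
move=> [LU [U' LU' [UU' U'U]]] [LV [V' LV' [VV' V'V]]] E.
have [d d0 Hd] := coord_denominator HL p c0.
have [X XU LX] := adeles_lift p LU; have [X' XU' LX'] := adeles_lift p LU'.
have [Y YV LY] := adeles_lift p LV; have [Y' YV' LY'] := adeles_lift p LV'.
set T := local_topology Om (inl p : place R K) in X XU LX X' XU' LX' Y YV LY Y' YV' LY'.
have WT : nbhs0 T (coord_nbhs (padic_nbhs p d)) by exists (padic_nbhs p d) => //; exists d.
pose I1 : 'M[cauchy_ring T]_n := cauchy_const T 1%:M.
have I1E : map_mx (fun s => \pi_(completion _) s : completion _) I1 = 1%:M.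
  rewrite cauchy_constE; apply/matrixP => i j; rewrite !mxE.
  by case: (i == j); [exact: to_completion1|exact: to_completion0].
have lim P Q := @map_cpi_eq _ T n P Q _ ^~ WT.
have [|N1 H1] := lim (X *m X') I1.
  by rewrite map_cpiM XU XU' -at_placeM UU' at_place1 I1E.
have [|N2 H2] := lim (X' *m X) I1.
  by rewrite map_cpiM XU XU' -at_placeM U'U at_place1 I1E.
have [|N3 H3] := lim (Y *m Y') I1.
  by rewrite map_cpiM YV YV' -at_placeM VV' at_place1 I1E.
have [|N4 H4] := lim (Y' *m Y) I1.
  by rewrite map_cpiM YV YV' -at_placeM V'V at_place1 I1E.
have [|N5 H5] := lim (X *m cauchy_const T M *m Y) (cauchy_const T M').
  rewrite !map_cpiM XU YV !cauchy_constE -!(adele_diag_at_place (inl p)).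
  by rewrite -!at_placeM E.
pose k := (N1 + N2 + N3 + N4 + N5)%N.
have get N (P Q : 'M[cauchy_ring T]_n) (P' Q' : 'M[Om]_n) : (N <= k)%N ->
    (forall k, (N <= k)%N -> forall i j,
       coord_nbhs (padic_nbhs p d) (cauchy_val (P i j) k - cauchy_val (Q i j) k)) ->
    cauchy_at k P = P' -> cauchy_at k Q = Q' ->
    exists s, [/\ OK s, ~ p s & congr_at s P' Q'].
  move=> Nk H <- <-; apply: (near_congr_at Hd) => i j; rewrite !mxE.
  exact: H.
have [|||s1 [O1 p1 C1]] := get N1 _ _ (cauchy_at k X * cauchy_at k X') 1 _ H1.
- by rewrite /k; lia.
- exact: cauchy_atM.
- exact: cauchy_at_const.
have [|||s2 [O2 p2 C2]] := get N2 _ _ (cauchy_at k X' * cauchy_at k X) 1 _ H2.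
- by rewrite /k; lia.
- exact: cauchy_atM.
- exact: cauchy_at_const.
have [|||s3 [O3 p3 C3]] := get N3 _ _ (cauchy_at k Y * cauchy_at k Y') 1 _ H3.
- by rewrite /k; lia.
- exact: cauchy_atM.
- exact: cauchy_at_const.
have [|||s4 [O4 p4 C4]] := get N4 _ _ (cauchy_at k Y' * cauchy_at k Y) 1 _ H4.
- by rewrite /k; lia.
- exact: cauchy_atM.
- exact: cauchy_at_const.
have [|||s5 [O5 p5 C5]] := get N5 _ _ (cauchy_at k X * M * cauchy_at k Y) M' _ H5.
- by rewrite /k; lia.
- by rewrite !cauchy_atM cauchy_at_const.
- exact: cauchy_at_const.
exists (s1 * s2 * (s3 * s4) * s5).
have O12 := OKM O1 O2; have O34 := OKM O3 O4.
have p12 := nonprimeM O1 O2 p1 p2; have p34 := nonprimeM O3 O4 p3 p4.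
have O14 := OKM O12 O34; have p14 := nonprimeM O12 O34 p12 p34.
split; [exact: OKM|exact: nonprimeM|].
exists (cauchy_at k X), (cauchy_at k X'), (cauchy_at k Y), (cauchy_at k Y').
split; [by split|split].
- by rewrite (_ : _ * s5 = s2 * s3 * s4 * s5 * s1); [apply: congr_atMl C1; do !apply: OKM|ring].
- by rewrite (_ : _ * s5 = s1 * s3 * s4 * s5 * s2); [apply: congr_atMl C2; do !apply: OKM|ring].
- by rewrite (_ : _ * s5 = s1 * s2 * s4 * s5 * s3); [apply: congr_atMl C3; do !apply: OKM|ring].
- by rewrite (_ : _ * s5 = s1 * s2 * s3 * s5 * s4); [apply: congr_atMl C4; do !apply: OKM|ring].
- exact: congr_atMl C5.
Qed.

End LocalEquivalence.

(** * From all finite places to an equivalence modulo [c] *)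

Section GlobalCongruence.
Variables (R : realType) (K : fieldExtType rat) (Om : falgType K) (L : set Om).
Hypothesis HL : is_order L.
Variables (c : nat) (B : pzRingType) (pi : Om -> B).
Hypotheses (c0 : (0 < c)%N) (red : order_reduction L c pi).
Variables (n : nat) (M M' : 'M[Om]_n).
Hypotheses (LM : Mat L M) (LM' : Mat L M').

Local Notation mpi := (map_mx pi : 'M[Om]_n -> 'M[B]_n).

(** The map from [OK] to the centre of ['M[B]_n], where the idempotents for gluing are found. *)
Let sigma (s : K) : 'M[B]_n := (pi s%:A)%:M.

Let L_scalar s : OK s -> L s%:A.
Proof. by move=> Os; apply: (orderZ HL) => //; exact: (order1 HL). Qed.

Let sigmaD s t : OK s -> OK t -> sigma (s + t) = sigma s + sigma t.
Proof.
move=> Os Ot; rewrite /sigma scalerDl (reductionD red); try exact: L_scalar.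
exact: raddfD.
Qed.

Let sigmaM s t : OK s -> OK t -> sigma (s * t) = sigma s * sigma t.
Proof.
move=> Os Ot; rewrite /sigma -mulmxE -scalar_mxM -(reductionM red); try exact: L_scalar.
by rewrite -scalerAl mul1r scalerA.
Qed.

Let sigma0 : sigma 0 = 0.
Proof. by rewrite /sigma scale0r (reduction0 HL red) raddf0. Qed.

Let sigma1 : sigma 1 = 1.
Proof. by rewrite /sigma scale1r (reduction1 red). Qed.

Let sigmaN s : OK s -> sigma (- s) = - sigma s.
Proof. by move=> Os; rewrite /sigma scaleNr (reductionN HL red) ?raddfN //; exact: L_scalar. Qed.

Let sigma_central s X : OK s -> sigma s * X = X * sigma s.
Proof.
move=> Os; rewrite -!mulmxE mul_scalar_mx; apply/matrixP => i j; rewrite !mxE.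
rewrite (bigD1 j) //= big1 ?addr0 => [|k kj].
  rewrite mxE eqxx mulr1n; have [x Lx <-] := reduction_surj red (X i j).
  by rewrite -!(reductionM red) //; [rewrite -scalerAl -scalerAr mul1r mulr1|exact: L_scalar|exact: L_scalar].
by rewrite mxE (negbTE kj) mulr0n mulr0.
Qed.

Let sigmaX s k : OK s -> sigma (s ^+ k) = (pi s%:A ^+ k)%:M.
Proof.
move=> Os; elim: k => [|k IH]; first by rewrite !expr0 sigma1.
by rewrite exprS sigmaM ?IH ?exprS //; [rewrite -mulmxE -scalar_mxM|exact: OKX].
Qed.

Let LK_scalar_mx s : OK s -> Mat L ((s%:A)%:M : 'M[Om]_n).
Proof. by move=> Os i j; rewrite mxE; apply: (orderMn HL); exact: L_scalar. Qed.

Let mpi_scalar s : OK s -> mpi (s%:A)%:M = sigma s.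
Proof.
move=> Os; apply/matrixP => i j; rewrite !mxE (reductionMn HL red) //.
exact: L_scalar.
Qed.

Lemma congr_at_reduction s P Q : OK s -> Mat L P -> Mat L Q -> congr_at L c s P Q ->
  sigma s * mpi P = sigma s * mpi Q.
Proof.
move=> Os LP LQ [Z LZ E]; have Ls := LK_scalar_mx Os.
rewrite -mpi_scalar // -!(mpiM HL red) //.
by apply: (eq_mpi HL red _ LZ E); exact: MatM.
Qed.

Variables (U V : 'M[place_product R Om]_n).
Hypotheses (LU : GL (integral_adeles L) U) (LV : GL (integral_adeles L) V).
Hypothesis UMV : U *m map_mx (adele_diag R) M *m V = map_mx (adele_diag R) M'.

Lemma equiv_at_place (p : finite_place K) :
  exists s, [/\ OK s, ~ p s & equiv_at (mpi M) (mpi M') (sigma s)].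
Proof.
have [s [Os ps [X [X' [Y [Y' [[LX LX' LY LY'] [E1 E2 E3 E4 E5]]]]]]]] :=
  local_equivalence HL p c0 LU LV UMV.
have L1 := @Mat1 _ _ _ HL n; have mpi1 := mpi1 HL red n.
exists s; split=> //; exists (mpi X), (mpi X'), (mpi Y), (mpi Y').
split.
- by rewrite -(mpiM HL red) // (congr_at_reduction Os _ _ E1) ?mpi1 ?mulr1 //; exact: MatM.
- by rewrite -(mpiM HL red) // (congr_at_reduction Os _ _ E2) ?mpi1 ?mulr1 //; exact: MatM.
- by rewrite -(mpiM HL red) // (congr_at_reduction Os _ _ E3) ?mpi1 ?mulr1 //; exact: MatM.
- by rewrite -(mpiM HL red) // (congr_at_reduction Os _ _ E4) ?mpi1 ?mulr1 //; exact: MatM.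
have LXM : Mat L (X * M) by exact: MatM.
by rewrite -!(mpiM HL red) // (congr_at_reduction Os _ _ E5) //; exact: MatM.
Qed.

(* The [s] annihilated modulo [c] by [1 - e], for an idempotent [e] modulo [c] at
   which the matrices are equivalent, form an ideal contained in no prime. *)
Lemma global_congruence : equiv_at (mpi M) (mpi M') 1.
Proof.
have [r Bfin] := reduction_fin red.
pose A : set K := [set s | OK s /\ exists e, [/\ OK e, equiv_at (mpi M) (mpi M') (sigma e),
  sigma e * sigma e = sigma e & sigma s * (1 - sigma e) = 0]].
have eq0 : equiv_at (mpi M) (mpi M') (sigma 0).
  by rewrite sigma0; exists 0, 0, 0, 0; rewrite !mul0r.
have idA : OK_ideal A.
  split.
  - by move=> s [].
  - split; first exact: OK0.
    by exists 0; rewrite !sigma0 !mul0r; split=> //; [exact: OK0|rewrite -sigma0].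
  - move=> s t [Os [e [Oe He ee se]]] [Ot [f [Of Hf ff tf]]]; split; first exact: OKD.
    (* The union of two idempotents: [1 - g] is [(1 - e) * (1 - f)], which annihilates both [s] and
       [t] modulo [c]. *)
    have Oef := OKM Oe Of; pose g := e + (1 - e) * f.
    have O1e : OK (1 - e) by apply: OKB => //; exact: OK1.
    have O1ef := OKM O1e Of.
    have gE : sigma g = sigma e + (1 - sigma e) * sigma f.
      rewrite /g sigmaD // sigmaM // sigmaD ?sigma1 ?sigmaN //; first exact: OK1.
      by rewrite -sub0r; apply: OKB => //; exact: OK0.
    have ef := sigma_central (sigma f) Oe.
    have gE1 : 1 - sigma g = (1 - sigma e) * (1 - sigma f) by rewrite gE; nc_ring.
    have gE2 : 1 - sigma g = (1 - sigma f) * (1 - sigma e).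
      rewrite gE [RHS](_ : _ = 1 - sigma e - sigma f + sigma f * sigma e); last by nc_ring.
      by rewrite -ef; nc_ring.
    have sg : (sigma s + sigma t) * (1 - sigma g) = 0.
      rewrite mulrDl {1}gE1 gE2 !mulrA se mul0r add0r.
      by rewrite tf mul0r.
    exists g; split.
    + exact: OKD.
    + by rewrite gE; apply: equiv_at_glue => // x; exact: sigma_central.
    + have ge : sigma g * sigma e = sigma e.
        rewrite gE [LHS](_ : _ = sigma e * sigma e + sigma f * sigma e -
          sigma e * (sigma f * sigma e)); last by nc_ring.
        by rewrite -ef mulrA ee addrK.
      have gf : sigma g * sigma f = sigma f.
        rewrite gE [LHS](_ : _ = sigma e * sigma f + (sigma f * sigma f) -
          sigma e * (sigma f * sigma f)); last by nc_ring.
        by rewrite ff addrAC subrr add0r.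
      rewrite {2 3}gE [LHS](_ : _ = sigma g * sigma e + sigma g * sigma f
        - (sigma g * sigma e) * sigma f); last by nc_ring.
      by rewrite ge gf; nc_ring.
    + by rewrite sigmaD.
  - move=> a s Oa [Os [e [Oe He ee se]]]; split; first exact: OKM.
    by exists e; split=> //; rewrite sigmaM // -mulrA se mulr0.
have [[_ [e [Oe He ee]]]|A1] := pselect (A 1).
  by rewrite sigma1 mul1r => /eqP; rewrite subr_eq0 => /eqP ->.
(* With [e = 0], since [c] is zero modulo [c]; a proper ideal [A] therefore lies in a nonzero
   prime. *)
have Ac : A c%:R.
  split; first by rewrite pmulrn; exact: OK_int.
  exists 0; split=> //; rewrite ?sigma0 ?mul0r //; first exact: OK0.
  rewrite subr0 mulr1 /sigma (_ : pi _ = 0) ?raddf0 //.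
  apply/(reduction_eq0 red); first by rewrite scaler_nat; exact/(orderMn HL)/(order1 HL).
  by exists 1; [exact: (order1 HL)|rewrite scaler_nat].
have [|p Ap] := prime_ideal_containing idA A1.
  by exists c%:R; rewrite // natr_ext_eq0 -lt0n.
have [s [Os ps Hs]] := equiv_at_place p.
(* An idempotent power of [s] serves as its own [e], so it belongs to [A], although it lies outside
   [p]. *)
have [k kE] := idempotent_power Bfin (pi s%:A).
have pX m : ~ p (s ^+ m).
  elim: m => [|m IH]; first by rewrite expr0; exact: prime_ideal1.
  by rewrite exprS; apply: nonprimeM => //; exact: OKX.
case: (pX k.+1); apply: Ap; split; first exact: OKX.
have ee : sigma (s ^+ k.+1) * sigma (s ^+ k.+1) = sigma (s ^+ k.+1).
  by rewrite !sigmaX // -mulmxE -scalar_mxM kE.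
exists (s ^+ k.+1); split=> //; first exact: OKX.
  by rewrite exprSr sigmaM //; [exact: equiv_atMl|exact: OKX].
by rewrite mulrBr mulr1 ee subrr.
Qed.

End GlobalCongruence.

(** * The diagonal embedding on matrices *)

Section AdeleDiagonal.
Variables (R : realType) (K : fieldExtType rat) (Om : falgType K) (L : set Om).
Variable n : nat.
Implicit Types X Y : 'M[Om]_n.

Local Notation diag := (map_mx (@adele_diag R K Om)).

Lemma adele_diagM X Y : diag (X *m Y) = diag X *m diag Y.
Proof.
apply: (@map_mulmx_on _ _ setT) => //.
- by apply: functional_extensionality_dep => v; exact: to_completion0.
- by move=> x y _ _; apply: functional_extensionality_dep => v; exact: to_completionD.
- by move=> x y _ _; apply: functional_extensionality_dep => v; exact: to_completionM.
Qed.

Lemma adele_diag1 : diag (1%:M : 'M[Om]_n) = 1%:M.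
Proof.
apply/matrixP => i j; rewrite !mxE; apply: functional_extensionality_dep => v.
by case: (i == j); [exact: to_completion1|exact: to_completion0].
Qed.

Lemma Mat_integral_adeles X : Mat L X -> Mat (integral_adeles L) (diag X).
Proof.
move=> LX i j; rewrite mxE.
have H (p : finite_place K) : local_order L (adele_diag R (X i j) (inl p)).
  by exists (CauchySeq (introT (asboolP _) (@cauchy_cst _ (local_topology Om (inl p : place R K)) (X i j)))) => // k; exact: LX.
split=> //; rewrite /adeles /= (_ : [set p | _] = set0); first exact: finite_set0.
by rewrite -subset0 => p; apply; exact: H.
Qed.

Lemma GL_integral_adeles X : GL L X -> GL (integral_adeles L) (diag X).
Proof.
move=> [LX [Y LY [XY YX]]]; split; first exact: Mat_integral_adeles.
exists (diag Y); first exact: Mat_integral_adeles.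
by rewrite -!adele_diagM XY YX adele_diag1.
Qed.

End AdeleDiagonal.

(** * Lifting an equivalence modulo [c] *)

Section GlobalEquivalence.
Variables (K : fieldExtType rat) (Om : falgType K) (L : set Om).
Hypothesis maxL : maximal_order L.
Let HL : is_order L := maxL.1.
Variable n : nat.
Implicit Types X M : 'M[Om]_n.

Lemma inverse_multiple M : GL setT M ->
  exists2 c, (0 < c)%N & exists2 N, Mat L N & M * N = 1 *+ c.
Proof.
move=> [_ [W _ [MW _]]].
have [||c c0 Hc] := @common_multiple ('I_n * 'I_n)%type (fun ij c => L (W ij.1 ij.2 *+ c)).
- by move=> ij d e; rewrite mulrnA; exact: (orderMn HL).
- by move=> ij; exact: (order_natmul HL).
exists c => //; exists (W *+ c); last by rewrite mulrnAr; congr (_ *+ c).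
move=> i j; rewrite (_ : (W *+ c) i j = W i j *+ c); first exact: (Hc (i, j)).
by elim: (c) => [|m IH]; rewrite ?mulr0n ?mulrS !mxE // IH.
Qed.

Variables (c : nat) (B : pzRingType) (pi : Om -> B).
Hypotheses (c0 : (0 < c)%N) (red : order_reduction L c pi).
Hypothesis Hn : ~ commutative_algebra Om -> (2 <= n)%N.
Local Notation mpi := (map_mx pi : 'M[Om]_n -> 'M[B]_n).

Lemma elementary_stabilizer M N (u : 'M[B]_n) : Mat L M -> Mat L N -> M * N = 1 *+ c ->
  two_sided_unit u ->
  exists E w, [/\ elementary E, mx_stabilizer (mpi M) w & u = E * w].
Proof.
move=> LM LN MN uu; have [n1|n1] := ltnP 1 n.
  apply: (stabilizer_decomposition maxL c0 red n1 LM LN) => //.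
  by rewrite -[LHS]/(M * N) MN raddfMn.
have comm : commutative_algebra Om.
  by apply: contrapT => /Hn; rewrite leqNgt ltnS n1.
exists 1, u; rewrite mul1r; split=> //; first exact: elementary1.
have BC (x y : B) : x * y = y * x.
  have [a La <-] := reduction_surj red x; have [b Lb <-] := reduction_surj red y.
  by rewrite -!(reductionM red) // comm.
(* For [n <= 1] the matrix ring over the commutative ring [B] is commutative, so every unit
   stabilizes [M]. *)
have MC (x y : 'M[B]_n) : x * y = y * x.
  case: n n1 x y => [|[|//]] _ x y; apply/matrixP => i j; first by case: i.
  by rewrite !mxE !big_ord1 !ord1 BC.
have [u' [uu' u'u]] := uu; exists u'; split=> //; [by exists u|by exists u'].
Qed.

Lemma global_equivalence M M' N N' : GL setT M -> GL setT M' ->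
  Mat L M -> Mat L M' -> Mat L N -> Mat L N' -> M * N = 1 *+ c -> M' * N' = 1 *+ c ->
  equiv_at (mpi M) (mpi M') 1 ->
  exists U V : 'M[Om]_n, [/\ GL L U, GL L V & U *m M *m V = M'].
Proof.
move=> [_ [W _ [MW WM]]] [_ [W' _ [MW' WM']]] LM LM' LN LN' MN MN'.
move=> [u [u' [v [v' []]]]]; rewrite !mul1r => uu u'u vv v'v uMv.
have [E [w [eE [w' [ww' w'w [x wx] [y w'y]]] uE]]] : exists E w,
    [/\ elementary E, mx_stabilizer (mpi M) w & u = E * w].
  by apply: (elementary_stabilizer LM LN MN); exists u'.
have [F [G [LF LG FG GF FE]]] := elementary_lift HL red eE.
(* From [Y = X * Z + C *+ c] and [X * D = 1 *+ c] follows [Y = X * (Z + D * C)]: divisibility by [X]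
   modulo [c] is true divisibility. *)
have solve X Y D D' : Mat L X -> Mat L Y -> Mat L D -> X * D = 1 *+ c ->
    mpi Y = mpi X * D' -> exists2 Z, Mat L Z & Y = X * Z.
  move=> LX LY LD XD YE; have [Z LZ ZD] := mpi_surj red D'.
  have [|C LC CE] := mpi_eq HL red LY (MatM HL LX LZ).
    by rewrite (mpiM HL red) // ZD.
  exists (Z + D * C); first by apply: (MatD HL) => //; exact: MatM.
  by rewrite mulrDr mulrA XD mulrnAl mul1r.
(* Modulo [c], [G * M'] is [E^-1 u M v = w M v = M x v]. *)
have [V1 LV1 V1E] : exists2 Z, Mat L Z & G * M' = M * Z.
  apply: (solve _ _ N (x * v)) => //; first exact: MatM.
  rewrite (mpiM HL red) // -uMv uE -FE !mulrA -(mpiM HL red) // GF (mpi1 HL red).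
  by rewrite mul1r wx.
(* Modulo [c], [M' v' y = u M y = u w' M = E M]. *)
have [V2 LV2 V2E] : exists2 Z, Mat L Z & F * M = M' * Z.
  apply: (solve _ _ N' (v' * y)) => //; first exact: MatM.
  rewrite (mpiM HL red) // FE -uMv mulrA -(mulrA _ v) vv mulr1 -mulrA -w'y uE.
  by rewrite mulrA -(mulrA E) ww' mulr1.
have V12 : V1 * V2 = 1.
  suff H : M * (V1 * V2) = M.
    by rewrite -[LHS]mul1r -[1](WM : W * M = 1) -mulrA H.
  by rewrite mulrA -V1E -mulrA -V2E mulrA GF mul1r.
have V21 : V2 * V1 = 1.
  suff H : M' * (V2 * V1) = M'.
    by rewrite -[LHS]mul1r -[1](WM' : W' * M' = 1) -mulrA H.
  by rewrite mulrA -V2E -mulrA -V1E mulrA FG mul1r.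
exists F, V1; split.
- by split=> //; exists G.
- by split=> //; exists V2.
- by rewrite -[LHS]/(F * M * V1) V2E -mulrA V21 mulr1.
Qed.

End GlobalEquivalence.

Theorem theorem2p3 (R : realType) (K : fieldExtType rat) (Om : falgType K)
    (HOm : finite_field_extension Om \/ central_division_algebra Om)
    (L : set Om) (HL : maximal_order L)
    (n : nat) (Hn : ~ commutative_algebra Om -> (2 <= n)%N)
    (M M' : 'M[Om]_n) (HM : InvMat L M) (HM' : InvMat L M') :
  (exists U V : 'M[Om]_n, [/\ GL L U, GL L V & U *m M *m V = M']) <->
  (exists U V : 'M[place_product R Om]_n,
     [/\ GL (integral_adeles L) U, GL (integral_adeles L) V &
         U *m map_mx (adele_diag R) M *m V = map_mx (adele_diag R) M']).
Proof.
have [GM LM] := HM; have [GM' LM'] := HM'; split=> [[U [V [LU LV <-]]]|[U [V [LU LV UMV]]]].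
  exists (map_mx (adele_diag R) U), (map_mx (adele_diag R) V).
  by split; [exact: GL_integral_adeles|exact: GL_integral_adeles|rewrite !adele_diagM].
have oL : is_order L := HL.1.
have [c1 c10 [N1 LN1 MN1]] := inverse_multiple HL GM.
have [c2 c20 [N2 LN2 MN2]] := inverse_multiple HL GM'.
(* A common multiple, so that one finite ring serves for both [M] and [M']. *)
have c0 : (0 < c1 * c2)%N by rewrite muln_gt0 c10.
have [B [pi red]] := order_reduction_exists oL c0.
apply: (@global_equivalence _ _ _ HL _ _ _ _ c0 red Hn _ _ (N1 *+ c2) (N2 *+ c1)) => //.
- exact: MatMn.
- exact: MatMn.
- by rewrite mulrnAr MN1 mulrnA.
- by rewrite mulrnAr MN2 -mulrnA mulnC.
exact: (global_congruence oL c0 red LM LM' LU LV UMV).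
Qed.
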